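(* Let $E$ be a Banach space such that either $E$ contains $\ell^\infty_n$ uniformly isomorphic ($n=1,2,\dots$), or for some $p\in(1,\infty)$ $E$ contains $\ell^p_n$ uniformly isomorphic and uniformly complemented ($n=1,2,\dots$). Then there exists a twisted sum of $\ell^2$ and $E$ which does not split.
   Context: $\ell^p_n$ is the $n$-dimensional scalar space with the $\ell^p$-norm. $E$ contains $\ell^p_n$ uniformly isomorphic if there is $C<\infty$ such that for each $n\ge1$ there is a subspace $E_n\subset E$ with Banach–Mazur distance $d(E_n,\ell^p_n)\le C$; it contains them uniformly isomorphic and uniformly complemented if moreover the $E_n$ can be chosen to be ranges of linear projections $E\to E_n$ of norm at most $C$. A quotient map is a bounded linear surjection $q:Y\to Z$ such that the induced map $Y/\ker q\to Z$ is an isometric isomorphism. A Banach space $Y$ is a twisted sum of Banach spaces $X$ and $Z$ (in this order) if there is a short exact sequence $0\to X\xrightarrow{j}Y\xrightarrow{q}Z\to 0$, i.e. $j(X)=\ker q$, with $j$ an isometric linear embedding and $q$ a quotient map. The twisted sum splits if there exists a bounded linear operator $v:Z\to Y$ with $qv=\mathrm{id}_Z$ (equivalently, there is a bounded linear projection from $Y$ onto $j(X)$). *)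

(* Defs.v *)
From HB Require Import structures.
From mathcomp Require Import all_boot all_order all_algebra.
From mathcomp Require Import all_classical all_reals all_analysis.
From mathcomp Require Import ring lra.
From mathcomp Require Import complex.

Set Implicit Arguments.
Unset Strict Implicit.
Unset Printing Implicit Defensive.

Import Order.TTheory GRing.Theory Num.Theory.
Import numFieldNormedType.Exports.

Local Open Scope classical_set_scope.
Local Open Scope ring_scope.

(* The scalar field is either [R] or [R[i]], so that both real and complex
   Banach spaces are covered. *)
Variant scalar_kind := RealScalars | ComplexScalars.

Definition scalar_field (R : realType) (k : scalar_kind) : numFieldType :=
  match k with
  | RealScalars => R : numFieldType
  | ComplexScalars => complex R : numFieldType
  end.

(* The norms of a [normedModType K] are [K]-valued, with values in the
   nonnegative reals of [K]; [absr] is the modulus as an element of [R]. *)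
Definition absr (R : realType) (k : scalar_kind) : scalar_field R k -> R :=
  match k return scalar_field R k -> R with
  | RealScalars => fun x : R => `|x|
  | ComplexScalars => fun z : complex R => complex.Re `|z|
  end.

Definition ofr (R : realType) (k : scalar_kind) : R -> scalar_field R k :=
  match k return R -> scalar_field R k with
  | RealScalars => fun x : R => x
  | ComplexScalars => fun x : R => Complex x 0
  end.

Definition rnorm (R : realType) (k : scalar_kind)
  (V : normedModType (scalar_field R k)) (x : V) : R := absr `|x|.

Section ScalarTheory.
Variables (R : realType) (k : scalar_kind).
Local Notation K := (scalar_field R k).
Local Notation ofr := (@ofr R k).

Lemma ofr_absr (x : K) : ofr (absr x) = `|x|.
Proof. by case: k x => //= -[a b]; rewrite normc_def. Qed.

Lemma ofr_norm_absr (V : normedModType K) (x : V) : ofr (rnorm x) = `|x|.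
Proof. by rewrite ofr_absr normr_id. Qed.

Lemma ofrK : {in Num.nneg, cancel ofr (@absr R k)}.
Proof.
case: k => x; rewrite nnegrE => x0 /=; first by rewrite ger0_norm.
by rewrite expr0n addr0 sqrtr_sqr ger0_norm.
Qed.

Lemma ler_ofr : {mono ofr : x y / x <= y}.
Proof. by case: k => x y //=; rewrite lecR. Qed.

Lemma ltr_ofr : {mono ofr : x y / x < y}.
Proof. by case: k => x y //=; rewrite ltcR. Qed.

Lemma ofrD x y : ofr (x + y) = ofr x + ofr y.
Proof. by case: k => //=; exact: (raddfD (real_complex R)). Qed.

Lemma ofrM x y : ofr (x * y) = ofr x * ofr y.
Proof. by case: k => //=; exact: (rmorphM (real_complex R)). Qed.

Lemma ofr0 : ofr 0 = 0. Proof. by case: k. Qed.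

Lemma ofr_inj : injective ofr.
Proof. by case: k => x y //= -[]. Qed.

Lemma absr_ge0 (x : K) : 0 <= absr x.
Proof. by rewrite -ler_ofr ofr0 ofr_absr. Qed.

Lemma absrD (x y : K) : absr (x + y) <= absr x + absr y.
Proof. by rewrite -ler_ofr ofrD !ofr_absr ler_normD. Qed.

Lemma absrM (x y : K) : absr (x * y) = absr x * absr y.
Proof. by apply: ofr_inj; rewrite ofrM !ofr_absr normrM. Qed.

Lemma absrN (x : K) : absr (- x) = absr x.
Proof. by apply: ofr_inj; rewrite !ofr_absr normrN. Qed.

Lemma absr0 : absr (0 : K) = 0.
Proof. by apply: ofr_inj; rewrite ofr_absr normr0 ofr0. Qed.

Lemma absr_eq0 (x : K) : absr x = 0 -> x = 0.
Proof. by move=> x0; apply/eqP; rewrite -normr_eq0 -ofr_absr x0 ofr0. Qed.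

Lemma ofr_pos (e : K) : 0 < e -> exists2 d : R, 0 < d & e = ofr d.
Proof.
move=> e0; exists (absr e); last by rewrite ofr_absr gtr0_norm.
by rewrite -ltr_ofr ofr0 ofr_absr normr_gt0 gt_eqF.
Qed.

End ScalarTheory.

Section ScalarComplete.
Variables (R : realType) (T : Type) (F : set_system T).
Hypothesis FF : ProperFilter F.

Let real_cauchy (f : T -> R) :
  (forall e, 0 < e -> exists t, \forall s \near F, `|f t - f s| < e) ->
  exists l, forall e, 0 < e -> \forall s \near F, `|f s - l| < e.
Proof.
move=> cf; have cF : cauchy (f @ F).
  apply: cauchy_exP => e e0; have [t ht] := cf _ e0.
  by exists (f t); exact: ht.
have /cvg_ex[l /cvgrPdist_lt fl] := R_complete (fmap_proper_filter f FF) cF.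
exists l => e e0.
by apply: filterS (fl _ e0) => s; rewrite distrC.
Qed.

Lemma scalar_cauchy (k : scalar_kind) (f : T -> scalar_field R k) :
  (forall e, 0 < e -> exists t, \forall s \near F, absr (f t - f s) < e) ->
  exists l, forall e, 0 < e -> \forall s \near F, absr (f s - l) < e.
Proof.
case: k f => f cf; first exact: real_cauchy.
have Rele (z : complex R) :
    `|complex.Re z| <= complex.Re `|z| /\ `|complex.Im z| <= complex.Re `|z|.
  case: z => a b; rewrite normc_def /=.
  by rewrite -!sqrtr_sqr; split; rewrite ler_wsqrtr// ?lerDl ?lerDr sqr_ge0.
have lere (z : complex R) :
    complex.Re `|z| <= `|complex.Re z| + `|complex.Im z|.
  case: z => a b; rewrite normc_def /=.
  rewrite -[leRHS]ger0_norm ?addr_ge0// -sqrtr_sqr ler_wsqrtr//.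
  rewrite sqrrD !real_normK ?num_real// lerD2r lerDl.
  by rewrite mulrn_wge0// mulr_ge0.
have [|a ha] := @real_cauchy (fun t => complex.Re (f t)).
  move=> e e0; have [t ht] := cf _ e0; exists t.
  apply: filterS ht => s; apply: le_lt_trans.
  by have [+ _] := Rele (f t - f s); case: (f t) (f s) => [? ?] [].
have [|b hb] := @real_cauchy (fun t => complex.Im (f t)).
  move=> e e0; have [t ht] := cf _ e0; exists t.
  apply: filterS ht => s; apply: le_lt_trans.
  by have [_ +] := Rele (f t - f s); case: (f t) (f s) => [? ?] [].
exists (Complex a b) => e e0.
have e20 : 0 < e / 2 by rewrite divr_gt0.
apply: filterS2 (ha _ e20) (hb _ e20) => s xa yb.
apply: (le_lt_trans (lere (f s - Complex a b))).
by rewrite [ltRHS]splitr; move: xa yb; case: (f s) => x y /=; exact: ltrD.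
Qed.

End ScalarComplete.

Section Ell2.
Variables (R : realType) (k : scalar_kind).
Local Notation K := (scalar_field R k).

Definition sqsum (x : nat -> K) : R^nat := series (fun n => absr (x n) ^+ 2).

Definition square_summable : {pred nat -> K} := fun x => `[< cvgn (sqsum x) >].

Let psnorm (x : nat -> K) n := Num.sqrt (sqsum x n).

Let nd_sqsum x : nondecreasing_seq (sqsum x).
Proof. by apply: nondecreasing_series => n _ _; rewrite exprn_ge0// absr_ge0. Qed.

Let sqsum_ge0 x n : 0 <= sqsum x n.
Proof. by apply: sumr_ge0 => i _; rewrite exprn_ge0// absr_ge0. Qed.

Let square_summable_ub x (M : R) : (forall n, sqsum x n <= M) -> x \in square_summable.
Proof.
move=> xM; apply/asboolP; apply: nondecreasing_is_cvgn => //.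
by exists M => _ [n _ <-].
Qed.

Let sqsum_le_lim x n : x \in square_summable -> sqsum x n <= limn (sqsum x).
Proof. by move=> /asboolP cx; exact: nondecreasing_cvgn_le. Qed.

Let psnormS x n : psnorm x n.+1 = Num.sqrt (psnorm x n ^+ 2 + absr (x n) ^+ 2).
Proof. by rewrite /psnorm sqr_sqrtr// /sqsum seriesSr. Qed.

Let sqrt_tri (a b c d : R) : 0 <= a -> 0 <= b -> 0 <= c -> 0 <= d ->
  Num.sqrt ((a + b) ^+ 2 + (c + d) ^+ 2) <=
  Num.sqrt (a ^+ 2 + c ^+ 2) + Num.sqrt (b ^+ 2 + d ^+ 2).
Proof.
move=> a0 b0 c0 d0.
set u := Num.sqrt (a ^+ 2 + c ^+ 2); set v := Num.sqrt (b ^+ 2 + d ^+ 2).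
have u2 : u ^+ 2 = a ^+ 2 + c ^+ 2 by rewrite sqr_sqrtr// addr_ge0// sqr_ge0.
have v2 : v ^+ 2 = b ^+ 2 + d ^+ 2 by rewrite sqr_sqrtr// addr_ge0// sqr_ge0.
have u0 : 0 <= u by exact: sqrtr_ge0.
have v0 : 0 <= v by exact: sqrtr_ge0.
rewrite -[leRHS]ger0_norm ?addr_ge0// -sqrtr_sqr ler_wsqrtr//.
have : a * b + c * d <= u * v.
  rewrite -ler_sqr ?nnegrE ?addr_ge0 ?mulr_ge0// exprMn u2 v2.
  rewrite -subr_ge0 (_ : _ - _ = (a * d - b * c) ^+ 2) ?sqr_ge0//; ring.
by rewrite !sqrrD u2 v2; lra.
Qed.

Let psnormD x y n : psnorm (x + y) n <= psnorm x n + psnorm y n.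
Proof.
elim: n => [|n ih].
  by rewrite /psnorm /sqsum /series/= !big_geq// sqrtr0 addr0.
rewrite !psnormS; apply: le_trans (sqrt_tri _ _ _ _); rewrite ?sqrtr_ge0 ?absr_ge0//.
rewrite ler_wsqrtr// lerD// ler_sqr ?nnegrE ?addr_ge0 ?sqrtr_ge0 ?absr_ge0//.
exact: absrD.
Qed.

Let sqsumZ a x n : sqsum (a *: x) n = absr a ^+ 2 * sqsum x n.
Proof.
by rewrite /sqsum /series/= mulr_sumr; apply: eq_bigr => i _; rewrite absrM exprMn.
Qed.

Let psnorm_le x n : x \in square_summable -> psnorm x n <= Num.sqrt (limn (sqsum x)).
Proof. by move=> xs; rewrite ler_wsqrtr// sqsum_le_lim. Qed.

Let psnorm_ub x (M : R) : (forall n, psnorm x n <= M) ->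
  x \in square_summable /\ Num.sqrt (limn (sqsum x)) <= M.
Proof.
move=> xM; have M0 : 0 <= M by apply: le_trans (xM 0%N); exact: sqrtr_ge0.
have xM2 n : sqsum x n <= M ^+ 2.
  by rewrite -[leLHS]sqr_sqrtr// ler_sqr ?nnegrE ?sqrtr_ge0//; exact: xM.
have xs := square_summable_ub xM2; split => //.
rewrite -[leRHS]ger0_norm// -sqrtr_sqr ler_wsqrtr//.
by apply: limr_le; [exact/asboolP|exact: nearW].
Qed.

Fact square_summable_submod : GRing.submod_closed square_summable.
Proof.
split=> [|a x y xs ys].
  apply: (@square_summable_ub _ 0) => n.
  by rewrite /sqsum /series/= big1// => i _; rewrite absr0 expr0n.
apply: (proj1 (@psnorm_ub _
  (absr a * Num.sqrt (limn (sqsum x)) + Num.sqrt (limn (sqsum y))) _)) => n.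
rewrite (le_trans (psnormD _ _ _))// lerD ?psnorm_le// /psnorm sqsumZ.
rewrite sqrtrM ?sqr_ge0// sqrtr_sqr ger0_norm ?absr_ge0//.
by rewrite ler_wpM2l ?absr_ge0// psnorm_le.
Qed.

HB.instance Definition _ :=
  GRing.isSubmodClosed.Build K (nat -> K) square_summable square_summable_submod.

Record ell2 := Ell2 { ell2_val :> nat -> K; _ : ell2_val \in square_summable }.

HB.instance Definition _ := [isSub for ell2_val].
HB.instance Definition _ := [Choice of ell2 by <:].
HB.instance Definition _ := [SubChoice_isSubLmodule of ell2 by <:].

Let ell2P (x : ell2) : (x : nat -> K) \in square_summable.
Proof. by case: x. Qed.

Definition ell2_norm (x : ell2) : K := ofr k (Num.sqrt (limn (sqsum x))).

Fact ell2_normD x y : ell2_norm (x + y) <= ell2_norm x + ell2_norm y.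
Proof.
rewrite -ofrD ler_ofr; apply: (proj2 (psnorm_ub _)) => n.
by rewrite (le_trans (psnormD _ _ _))// lerD// psnorm_le// ell2P.
Qed.

Fact ell2_normZ (a : K) x : ell2_norm (a *: x) = `|a| * ell2_norm x.
Proof.
rewrite -ofr_absr -ofrM; congr ofr.
rewrite (_ : sqsum _ = absr a ^+ 2 *: sqsum x); last first.
  by apply/funext => n; rewrite sqsumZ.
rewrite limZr; last exact/asboolP/ell2P.
by rewrite sqrtrM ?sqr_ge0// sqrtr_sqr ger0_norm// absr_ge0.
Qed.

Let absr_le_psnorm x n : absr (x n) <= psnorm x n.+1.
Proof.
rewrite psnormS -[leLHS]ger0_norm ?absr_ge0// -sqrtr_sqr ler_wsqrtr//.
by rewrite lerDr sqr_ge0.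
Qed.

Fact ell2_norm_eq0 x : ell2_norm x = 0 -> x = 0.
Proof.
rewrite -(ofr0 R k) => /ofr_inj x0; apply: val_inj; apply/funext => n.
apply: absr_eq0; apply/le_anti; rewrite absr_ge0 andbT -x0.
by rewrite (le_trans (absr_le_psnorm _ _))// psnorm_le// ell2P.
Qed.

HB.instance Definition _ :=
  Lmodule_isNormed.Build K ell2 ell2_normD ell2_normZ ell2_norm_eq0.

Lemma rnorm_ell2 (x : ell2) : rnorm x = Num.sqrt (limn (sqsum x)).
Proof. by apply: (@ofr_inj R k); rewrite ofr_norm_absr. Qed.

Let psnorm_near (T : Type) (F : set_system T) (FF : ProperFilter F)
    (f : T -> nat -> K) (l : nat -> K) n :
  (forall n e, 0 < e -> \forall s \near F, absr (f s n - l n) < e) ->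
  forall e, 0 < e -> \forall s \near F, psnorm (f s - l) n < e.
Proof.
move=> fl; elim: n => [|n ih] e e0.
  by apply: nearW => s; rewrite /psnorm /sqsum /series/= big_geq// sqrtr0.
have e20 : 0 < e / 2 by rewrite divr_gt0.
apply: filterS2 (ih _ e20) (fl n _ e20) => s h1 h2.
rewrite [ltRHS]splitr psnormS; apply: le_lt_trans (ltrD h1 h2).
set a := psnorm _ _; set b := absr _.
have a0 : 0 <= a by exact: sqrtr_ge0.
have b0 : 0 <= b by exact: absr_ge0.
rewrite -[leRHS]ger0_norm ?addr_ge0// -sqrtr_sqr ler_wsqrtr//.
by rewrite sqrrD lerD2r lerDl mulrn_wge0// mulr_ge0.
Qed.

Fact ell2_complete (F : set_system ell2) : ProperFilter F -> cauchy F -> cvg F.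
Proof.
move=> FF /cauchy_ballP cF.
have cF2 (e : R) : 0 < e -> exists2 A : set ell2, F A &
    forall x y n, A x -> A y -> psnorm (val x - val y) n < e.
  move=> e0; have := cF (ofr k e); rewrite -(ofr0 R k) ltr_ofr => /(_ e0).
  case=> -[A B] /= [FA FB] AB; exists (A `&` B); first exact: filterI.
  move=> x y n [Ax _] [_ By].
  have := AB (x, y) (conj Ax By); rewrite -ball_normE /ball_/=.
  rewrite -ofr_norm_absr ltr_ofr rnorm_ell2; apply: le_lt_trans.
  exact: (psnorm_le n (ell2P (x - y))).
have /choice[l hl] n : exists l, forall e : R, 0 < e ->
    \forall x \near F, absr ((x : ell2) n - l) < e.
  apply: scalar_cauchy => e e0; have [A FA hA] := cF2 _ e0.
  have [x Ax] := filter_ex FA; exists x.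
  apply: filterS FA => y Ay; apply: le_lt_trans (hA x y n.+1 Ax Ay).
  exact: (absr_le_psnorm (val x - val y)).
have hA2 (e : R) : 0 < e -> \forall x \near F,
    forall n, psnorm (val (x : ell2) - l) n <= e.
  move=> e0; have [A FA hA] := cF2 _ e0; apply: filterS (FA) => x Ax n.
  apply/ler_addgt0Pr => d d0.
  have [y [Ay yl]] : exists y, A y /\ psnorm (val (y : ell2) - l) n < d.
    by apply: (@filter_ex _ F); apply: filterI => //; exact: (psnorm_near FF n hl d0).
  have -> : val x - l = (val x - val y) + (val y - l).
    by rewrite addrA subrK.
  by rewrite (le_trans (psnormD _ _ _))// lerD// ltW// hA.
have [x0 hx0] := filter_ex (hA2 1 ltr01).
have ls : l \in square_summable.
  have -> : l = val x0 - (val x0 - l) by rewrite opprB addrC subrK.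
  by rewrite rpredB ?ell2P//; have [] := psnorm_ub hx0.
apply/cvg_ex; exists (Ell2 ls); apply/cvgrPdist_le => e /ofr_pos[d d0 ->].
apply: filterS (hA2 _ d0) => x xl.
rewrite distrC -ofr_norm_absr ler_ofr rnorm_ell2.
by have [] := psnorm_ub xl.
Qed.

HB.instance Definition _ := Uniform_isComplete.Build ell2 ell2_complete.

End Ell2.

Section Notions.
Variables (R : realType) (k : scalar_kind).
Local Notation K := (scalar_field R k).

(* The [\ell^p] norm on [K^n], with [p] a positive real or [+oo]; [-oo] is a
   junk value. *)
Definition lp_norm (p : \bar R) (n : nat) (x : 'rV[K]_n) : R :=
  match p with
  | r%:E%E => (\sum_(i < n) absr (x 0 i) `^ r) `^ r^-1
  | +oo%E => \big[Num.max/0]_(i < n) absr (x 0 i)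
  | -oo%E => 0
  end.

(* In the next definitions a normed space is given as a linear subspace [A] of
   an ambient module, together with a function [N] which is a norm on [A]. *)

Definition op_norm (V W : lmodType K) (A : {pred V}) (NV : V -> R) (NW : W -> R)
    (f : V -> W) : \bar R :=
  ereal_sup [set (NW (f x))%:E | x in [set x | x \in A /\ NV x <= 1]].

Definition linear_iso_on (V W : lmodType K) (A : {pred V}) (B : {pred W})
    (T : V -> W) (S : W -> V) : Prop :=
  [/\ forall a, {in A &, forall x y, T (a *: x + y) = a *: T x + T y},
      {in A, forall x, T x \in B}, {in B, forall y, S y \in A},
      {in A, cancel T S} & {in B, cancel S T}].

Definition banach_mazur (V W : lmodType K) (A : {pred V}) (NV : V -> R)
    (B : {pred W}) (NW : W -> R) : \bar R :=
  ereal_inf [set d | exists (T : V -> W) (S : W -> V), linear_iso_on A B T S /\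
                     d = (op_norm A NV NW T * op_norm B NW NV S)%E].

Definition contains_lpn_uniformly (p : \bar R) (E : normedModType K) : Prop :=
  exists C : R, forall n, (1 <= n)%N -> exists En : {pred E},
    GRing.submod_closed En /\
    (banach_mazur En (@rnorm R k E) predT (@lp_norm p n) <= C%:E)%E.

Definition projection_onto (E : normedModType K) (A : {pred E})
    (P : {linear E -> E}) : Prop :=
  (forall x, P x \in A) /\ {in A, forall x, P x = x}.

Definition contains_lpn_uniformly_complemented (p : \bar R)
    (E : normedModType K) : Prop :=
  exists C : R, forall n, (1 <= n)%N -> exists En : {pred E},
    [/\ GRing.submod_closed En,
        (banach_mazur En (@rnorm R k E) predT (@lp_norm p n) <= C%:E)%E &
        exists P : {linear E -> E}, projection_onto En P /\
          (op_norm predT (@rnorm R k E) (@rnorm R k E) P <= C%:E)%E].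

Definition bounded_op (V W : normedModType K) (f : {linear V -> W}) : Prop :=
  (op_norm predT (@rnorm R k V) (@rnorm R k W) f < +oo)%E.

(* The norm of the class of [y] in [Y / ker q]. *)
Definition quotient_norm (Y Z : normedModType K) (q : {linear Y -> Z})
    (y : Y) : R :=
  inf [set rnorm (y + u) | u in [set u | q u = 0]].

Definition quotient_map (Y Z : normedModType K) (q : {linear Y -> Z}) : Prop :=
  [/\ bounded_op q, forall z, exists y, q y = z &
      forall y, rnorm (q y) = quotient_norm q y].

Definition twisted_sum (X Y Z : completeNormedModType K)
    (j : {linear X -> Y}) (q : {linear Y -> Z}) : Prop :=
  [/\ forall x, rnorm (j x) = rnorm x, quotient_map q &
      range j = [set y | q y = 0]].

Definition splits (Y Z : normedModType K) (q : {linear Y -> Z}) : Prop :=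
  exists v : {linear Z -> Y}, bounded_op v /\ forall z, q (v z) = z.

End Notions.

(* Main.v *)
(* The twisted sum is the pull-back of the Kalton-Peck space along an operator
   A : E -> \ell^2.  It consists of the pairs (x, e) of a scalar sequence and a
   vector of E such that, over all finitely supported y with |y|_2 <= 1, the linear
   functionals
       (x, e) |-> \sum_j y_j (x_j - ln |y_j| (A e)_j)
   are bounded; the norm is the maximum of |e| and of their supremum.  That
   (x, e) |-> e is a quotient map comes from the nonlinear selection
   x_j = (A e)_j ln (2 |(A e)_j| / |e|) together with
   u v |ln u - ln v| <= u^2 + v^2.

   The operator A is glued from blocks that map onto \ell^2_n and are given, on a
   copy of \ell^p({-1,1}^n) in E, by the Rademacher coefficients.  They are uniformly
   bounded on \ell^p for 1 < p by Khintchine's inequality (and are extended from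
   \ell^\infty({-1,1}^n) to E by the Hahn-Banach theorem).  If L is the linear part
   of a bounded lifting of E, then evaluating L on the Rademacher functions bounds
   its diagonal coefficients, whereas evaluating it on the translates of the function
   Im \prod_j (1 + i eps_j / \sqrt n), whose Rademacher coefficients are all equal
   to 1 / \sqrt n, and averaging over the translations forces these coefficients to
   be of order ln n. *)
Require Import Defs.
From HB Require Import structures.
From mathcomp Require Import all_boot all_order all_algebra.
From mathcomp Require Import all_classical all_reals all_analysis.
From mathcomp Require Import ring lra complex.

Set Implicit Arguments.
Unset Strict Implicit.
Unset Printing Implicit Defensive.

Import Order.TTheory GRing.Theory Num.Theory.
Import numFieldNormedType.Exports.

Local Open Scope classical_set_scope.
Local Open Scope ring_scope.

(** * Entropy and exponential inequalities *)

Section RealInequalities.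
Variable R : realType.
Implicit Types u v x y p t : R.

(** By symmetry u <= v, and then [ln (v / u) <= v / u] bounds the left side by v^2. When u = 0 the
    factor u removes the default value of [ln 0]. *)
Lemma ln_ratio_bound u v : 0 <= u -> 0 <= v ->
  u * v * `|ln u - ln v| <= u ^+ 2 + v ^+ 2.
Proof.
wlog uv : u v / u <= v => [hw|] u0 v0.
  case: (leP u v) => [uv|/ltW vu]; first exact: hw.
  by rewrite (mulrC u) distrC [leRHS]addrC; exact: hw.
move: u0; rewrite le_eqVlt => /predU1P[<-|u0].
  by rewrite !mul0r addr_ge0// sqr_ge0.
have vp : 0 < v by exact: lt_le_trans uv.
rewrite distrC ger0_norm ?subr_ge0 ?ler_ln ?posrE// -ln_div ?posrE//.
have h : ln (v / u) <= v / u by rewrite ltW// ln_sublinear// divr_gt0.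
apply: (@le_trans _ _ (u * v * (v / u))); first by rewrite ler_wpM2l// mulr_ge0// ltW.
rewrite (_ : _ * _ = v ^+ 2); first by rewrite lerDr sqr_ge0.
by field; rewrite gt_eqF.
Qed.

(** Inverse square of [1 - y / 2 <= expR (- (y / 2))]: a rational upper bound that reduces the next
    lemma to algebra. *)
Lemma expR_le_ratio y : `|y| <= 1 -> expR y <= (1 - y / 2) ^- 2.
Proof.
rewrite ler_norml => /andP[y1 y2].
have -> : expR y = expR (- (y / 2)) ^- 2.
  by rewrite -expRM_natr -expRN; congr expR; field.
have h : 0 < 1 - y / 2 by lra.
rewrite lef_pV2 ?posrE ?exprn_gt0 ?expR_gt0//.
by rewrite ler_sqr ?nnegrE ?expR_ge0 ?(ltW h)//; exact: expR_ge1Dx.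
Qed.

Lemma cosh_le_gauss y : `|y| <= 1 -> expR y + expR (- y) <= 2 * expR (2 * y ^+ 2).
Proof.
move=> y1; apply: (@le_trans _ _ (2 * (1 + 2 * y ^+ 2))); last first.
  by rewrite ler_wpM2l// expR_ge1Dx.
have := expR_le_ratio y1; have := @expR_le_ratio (- y).
rewrite normrN => /(_ y1); move: y1; rewrite ler_norml => /andP[y1 y2] h1 h2.
apply: (le_trans (lerD h2 h1)).
have a0 : 0 < 1 - y / 2 by lra.
have b0 : 0 < 1 - (- y) / 2 by lra.
(* Over the common denominator the gap becomes a polynomial in u = y^2 with 0 <= u <= 1; the
   generous factor 2 in the Gaussian exponent leaves room for its sign. *)
rewrite -subr_ge0.
have -> : 2 * (1 + 2 * y ^+ 2) - ((1 - y / 2) ^- 2 + (1 - - y / 2) ^- 2) =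
  ((1 - y / 2) * (1 - - y / 2)) ^- 2 * (2 * (1 + 2 * y ^+ 2) * ((1 - y ^+ 2 / 4) ^+ 2)
    - 2 * (1 + y ^+ 2 / 4)).
  by field; apply/andP; split; lra.
rewrite mulr_ge0 ?invr_ge0 ?exprn_ge0 ?mulr_ge0 ?(ltW a0) ?(ltW b0)//.
have : y ^+ 2 <= 1 by nra.
have : 0 <= y ^+ 2 by exact: sqr_ge0.
move: (y ^+ 2) => u u0 u1; nra.
Qed.

(** Young's inequality with conjugate exponent q = p / (p - 1), followed by s^q <= q^q e^s, which
    comes from s / q <= e^(s / q). *)
Lemma young_expR p t s : 1 < p -> 0 <= t -> 0 <= s ->
  t * s <= t `^ p + (p / (p - 1)) `^ (p / (p - 1)) * expR s.
Proof.
move=> p1 t0 s0; set q := p / (p - 1).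
have q0 : 0 < q by rewrite divr_gt0//; lra.
have p0 : 0 < p by lra.
have q1 : 1 <= q by rewrite ler_pdivlMr ?subr_gt0//; lra.
have pq : p^-1 + q^-1 = 1 by rewrite /q; field; apply/andP; split; lra.
have := conjugate_powR t0 s0 p0 q0 pq => h; apply: (le_trans h).
rewrite lerD//.
  by rewrite ler_pdivrMr// ler_peMr ?powR_ge0// ltW.
apply: (@le_trans _ _ (s `^ q)).
  by rewrite ler_pdivrMr// ler_peMr ?powR_ge0.
have -> : expR s = expR (s / q) `^ q by rewrite -expRM divfK// gt_eqF.
have q0' := ltW q0.
rewrite -powRM ?expR_ge0//; apply: ge0_ler_powR; rewrite ?nnegrE//.
  by rewrite mulr_ge0 ?expR_ge0.
rewrite mulrC -ler_pdivrMr//; apply: le_trans (expR_ge1Dx _).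
by rewrite lerDr.
Qed.

End RealInequalities.

(** * Rademacher sums and Riesz products on the discrete cube *)

Section Rademacher.
Variables (R : realType).

(** Independence of the signs: the sum over the cube factors into the product of the e^(y_i) + e^(-
    y_i), each at most 2 exp(2 y_i^2). *)
Lemma sum_expR_signs n (y : 'I_n -> R) :
  \sum_(i < n) y i ^+ 2 <= 1 ->
  \sum_(e : {ffun 'I_n -> bool}) expR (\sum_(i < n) y i * (-1) ^+ e i) <=
    2 ^+ n * expR 2.
Proof.
move=> y1.
have -> : \sum_(e : {ffun 'I_n -> bool}) expR (\sum_(i < n) y i * (-1) ^+ e i) =
   \sum_(e : {ffun 'I_n -> bool}) \prod_(i < n) expR (y i * (-1) ^+ e i).
  by apply: eq_bigr => e _; rewrite expR_sum.
rewrite -(bigA_distr_bigA (fun i (b : bool) => expR (y i * (-1) ^+ b))).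
apply: (@le_trans _ _ (\prod_(i < n) (2 * expR (2 * y i ^+ 2)))).
  apply: ler_prod => i _; rewrite big_bool/= expr1 expr0 mulrN1 mulr1.
  rewrite addr_ge0 ?expR_ge0//= addrC cosh_le_gauss//.
  rewrite -(@ler_sqr _ `|y i| 1) ?nnegrE// expr1n real_normK ?num_real//.
  by apply: le_trans y1; rewrite (bigD1 i)//= lerDl sumr_ge0// => j _; exact: sqr_ge0.
rewrite big_split/= prodr_const card_ord ler_wpM2l ?exprn_ge0//.
by rewrite -expR_sum ler_expR -mulr_sumr ler_piMr.
Qed.

(* For [p < 2] this is dual to Khintchine's inequality in [L^q], [q = p / (p - 1)]. *)
Lemma rademacher_coef_bound (p : R) : 1 < p -> exists2 C : R, 0 < C &
  forall n (x : {ffun 'I_n -> bool} -> R), \sum_(e : {ffun 'I_n -> bool}) `|x e| `^ p <= 2 ^+ n ->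
    \sum_(i < n) (2 ^- n * \sum_(e : {ffun 'I_n -> bool}) (-1) ^+ e i * x e) ^+ 2 <= C ^+ 2.
Proof.
move=> p1; set q := p / (p - 1); set D := q `^ q.
have D0 : 0 <= D by exact: powR_ge0.
exists (1 + D * (expR 2 + expR 2)).
  by rewrite ltr_pwDl// mulr_ge0// addr_ge0// expR_ge0.
move=> n x xp; pose b (i : 'I_n) := 2 ^- n * \sum_(e : {ffun 'I_n -> bool}) (-1) ^+ e i * x e.
set r2 := \sum_(i < n) _; pose r := Num.sqrt r2.
have r2_0 : 0 <= r2 by apply: sumr_ge0 => i _; exact: sqr_ge0.
have rE : r ^+ 2 = r2 by rewrite sqr_sqrtr.
have r0 : 0 <= r by exact: sqrtr_ge0.
rewrite -rE ler_sqr ?nnegrE//; last first.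
  by rewrite addr_ge0// mulr_ge0// addr_ge0// expR_ge0.
have [->|rn0] := eqVneq r 0.
  by rewrite addr_ge0// mulr_ge0// addr_ge0// expR_ge0.
pose y i := b i / r.
have y1 : \sum_(i < n) y i ^+ 2 = 1.
  rewrite /y; under eq_bigr do rewrite expr_div_n.
  by rewrite -mulr_suml -/r2 -rE divff// expf_neq0.
(* Duality: for the normalized coefficient vector y, r is the average of x against the Rademacher
   sum S of y. [young_expR] is then applied pointwise with s = |S|, and e^|S| <= e^S + e^(- S). *)
have -> : r = 2 ^- n * \sum_(e : {ffun 'I_n -> bool}) x e * \sum_(i < n) y i * (-1) ^+ e i.
  have -> : r = \sum_(i < n) y i * b i.
    rewrite /y; under eq_bigr do rewrite mulrAC -expr2.
    by rewrite -mulr_suml -/r2 -rE expr2 mulfK.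
  under [in RHS]eq_bigr do rewrite mulr_sumr.
  rewrite exchange_big mulr_sumr/=; apply: eq_bigr => i _.
  rewrite /b !mulr_sumr; apply: eq_bigr => e _; ring.
rewrite ler_pdivrMl ?exprn_gt0//.
apply: (@le_trans _ _ (\sum_(e : {ffun 'I_n -> bool}) (`|x e| `^ p +
    D * (expR (\sum_(i < n) y i * (-1) ^+ e i) +
         expR (\sum_(i < n) - y i * (-1) ^+ e i))))).
  apply: ler_sum => e _; set S := \sum_(i < n) y i * _.
  have -> : \sum_(i < n) - y i * (-1) ^+ e i = - S.
    by rewrite -sumrN; apply: eq_bigr => i _; rewrite mulNr.
  rewrite (le_trans (ler_norm _))// normrM (le_trans (young_expR p1 _ _))//.
  rewrite lerD2l ler_wpM2l//.
  have [S0|S0] := leP 0 S; first by rewrite ger0_norm// lerDl expR_ge0.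
  by rewrite ltr0_norm// lerDr expR_ge0.
rewrite big_split/= mulrDr mulr1 lerD// -mulr_sumr mulrCA ler_wpM2l//.
rewrite big_split/= mulrDr lerD// sum_expR_signs//.
  by rewrite y1.
by under eq_bigr do rewrite sqrrN; rewrite y1.
Qed.

(** For t = 1 / sqrt (n + 1), the product Z of the factors 1 + i t eps_j satisfies |Z|^2 = (1 +
    t^2)^(n + 1) <= e, and X is Im Z. After multiplication by eps_i and summation over the cube,
    each factor j != i contributes 2 and the i-th one contributes 2 i t. *)
Lemma riesz_product n : exists2 X : {ffun 'I_n.+1 -> bool} -> R,
  forall e, `|X e| <= expR 1 &
  forall i, \sum_(e : {ffun 'I_n.+1 -> bool}) (-1) ^+ e i * X e = 2 ^+ n.+1 / Num.sqrt n.+1%:R.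
Proof.
set t : R := (Num.sqrt n.+1%:R)^-1.
have t2 : t ^+ 2 = n.+1%:R^-1 by rewrite exprVn sqr_sqrtr.
pose Z (e : {ffun 'I_n.+1 -> bool}) : complex R :=
  \prod_i Complex 1 (t * (-1) ^+ e i).
exists (fun e => complex.Im (Z e)) => [e|i].
  have : complex.Re (Z e) ^+ 2 + complex.Im (Z e) ^+ 2 <= expR 1.
    have -> : complex.Re (Z e) ^+ 2 + complex.Im (Z e) ^+ 2 = (1 + t ^+ 2) ^+ n.+1.
      pose N (z : complex R) := complex.Re z ^+ 2 + complex.Im z ^+ 2.
      have NM z w : N (z * w) = N z * N w.
        by case: z => a b; case: w => c d; rewrite /N /=; ring.
      rewrite -/(N (Z e)) /Z (big_morph N (id1 := 1) NM); last first.
        by rewrite /N /= expr1n expr0n addr0.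
      rewrite -[in RHS](card_ord n.+1) -prodr_const; apply: eq_bigr => i _.
      by rewrite /N /= expr1n exprMn sqrr_sign mulr1.
    have -> : expR 1 = expR (t ^+ 2) ^+ n.+1 :> R.
      by rewrite -expRM_natr t2 mulVf.
    by rewrite lerXn2r ?nnegrE ?addr_ge0 ?sqr_ge0 ?expR_ge0// expR_ge1Dx.
  move: (complex.Re _) (complex.Im _) => a b.
  have e1 : 1 <= expR (1 : R) by apply: le_trans (expR_ge1Dx _); rewrite lerDl.
  move=> ab; rewrite -(@ler_sqr _ `|b|) ?nnegrE ?expR_ge0// real_normK ?num_real//.
  rewrite (@le_trans _ _ (expR 1))//; last by rewrite expr2 ler_peMr// expR_ge0.
  by apply: le_trans ab; rewrite lerDr sqr_ge0.
have -> : \sum_(e : {ffun 'I_n.+1 -> bool}) (-1) ^+ e i * complex.Im (Z e) =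
  complex.Im (\sum_(e : {ffun 'I_n.+1 -> bool})
    \prod_j ((if j == i then (-1) ^+ e j else 1) * Complex 1 (t * (-1) ^+ e j))).
  rewrite (raddf_sum (@complex.Im R)) /=; apply: eq_bigr => e _.
  rewrite big_split/= -/(Z e) -big_mkcond/= big_pred1_eq.
  case: (e i); case: (Z e) => a b /=; ring.
rewrite -(bigA_distr_bigA (fun j (b : bool) => (if j == i then (-1) ^+ b else 1) *
  Complex 1 (t * (-1) ^+ b))).
rewrite (bigD1 i)//= [X in _ * X](eq_bigr (fun=> Complex 2 0)); last first.
  move=> j /negbTE ->; rewrite big_bool/= !mul1r expr1 expr0.
  by transitivity (Complex (1 + 1) (t * -1 + t * 1)) => //; congr Complex; ring.
rewrite prodr_const cardC1 card_ord/= big_bool/= eqxx expr1 expr0 mul1r.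
have -> : (Complex 2 0 : complex R) ^+ n = Complex (2 ^+ n) 0.
  by rewrite -!/(real_complex R _) rmorphXn.
rewrite expr1 expr0 mulN1r.
have -> : - Complex 1 (t * -1) + Complex 1 (t * 1) = Complex 0 (2 * t) :> complex R.
  by transitivity (Complex (- 1 + 1) (- (t * -1) + t * 1)) => //; congr Complex; ring.
by transitivity (0 * 0 + 2 * t * 2 ^+ n) => //=; rewrite exprS; ring.
Qed.

End Rademacher.

(** * The twisted sum attached to an operator into \ell^2 *)

Section Scalars.
Variables (R : realType) (k : scalar_kind).
Local Notation K := (scalar_field R k).

Definition mklin (U V : lmodType K) (f : U -> V) (fl : linear f) : {linear U -> V} :=
  HB.pack f (GRing.isLinear.Build K U V *:%R f fl).

Lemma absr_ofr (x : R) : absr (ofr k x) = `|x|.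
Proof. by case: k => //=; rewrite expr0n addr0 sqrtr_sqr. Qed.

Lemma ofr1 : ofr k (1 : R) = 1. Proof. by case: k. Qed.

Lemma ofrN (x : R) : ofr k (- x) = - ofr k x.
Proof. by apply/eqP; rewrite -addr_eq0 -ofrD addNr ofr0. Qed.

Lemma ofr_sum I (s : seq I) (F : I -> R) :
  ofr k (\sum_(i <- s) F i) = \sum_(i <- s) ofr k (F i).
Proof. exact: (big_morph _ (@ofrD R k) (@ofr0 R k)). Qed.

Lemma ofrV (x : R) : ofr k x^-1 = (ofr k x)^-1.
Proof.
have [->|x0] := eqVneq x 0; first by rewrite invr0 ofr0 invr0.
have ox : ofr k x != 0 by apply: contra x0 => /eqP; rewrite -(ofr0 R k) => /ofr_inj ->.
by apply: (mulfI ox); rewrite divff// -ofrM divff// ofr1.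
Qed.

Lemma absr1 : absr (1 : K) = 1. Proof. by rewrite -ofr1 absr_ofr normr1. Qed.

Lemma absrV (x : K) : absr x^-1 = (absr x)^-1.
Proof. by apply: (@ofr_inj R k); rewrite ofr_absr ofrV ofr_absr normfV. Qed.

Lemma absr_sum I (s : seq I) (P : pred I) (F : I -> K) :
  absr (\sum_(i <- s | P i) F i) <= \sum_(i <- s | P i) absr (F i).
Proof.
elim/big_ind2 : _ => [|x x' y y' h h'|i _]; rewrite ?absr0//.
by rewrite (le_trans (absrD _ _))// lerD.
Qed.

Lemma absr_sign n : absr ((-1) ^+ n : K) = 1.
Proof. by rewrite -signr_odd; case: odd; rewrite ?expr1 ?expr0 ?absrN absr1. Qed.

Section Norm.
Variable V : normedModType K.
Implicit Types x y : V.

Lemma rnorm_ge0 x : 0 <= rnorm x. Proof. exact: absr_ge0. Qed.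

Lemma rnormD x y : rnorm (x + y) <= rnorm x + rnorm y.
Proof. by rewrite -(ler_ofr k) ofrD !ofr_norm_absr ler_normD. Qed.

Lemma rnormZ (a : K) x : rnorm (a *: x) = absr a * rnorm x.
Proof. by apply: (@ofr_inj R k); rewrite ofrM !ofr_norm_absr ofr_absr normrZ. Qed.

Lemma rnorm0 : rnorm (0 : V) = 0. Proof. by rewrite /rnorm normr0 absr0. Qed.

Lemma rnormN x : rnorm (- x) = rnorm x. Proof. by rewrite /rnorm normrN. Qed.

Lemma rnorm_eq0 x : rnorm x = 0 -> x = 0.
Proof. by move=> /absr_eq0 /normr0_eq0. Qed.

End Norm.

Lemma ler_sum_uniq (I : eqType) (s t : seq I) (F : I -> R) :
  uniq s -> uniq t -> {subset s <= t} -> (forall i, 0 <= F i) ->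
  \sum_(i <- s) F i <= \sum_(i <- t) F i.
Proof.
move=> us ut st F0.
have pt : perm_eq t (s ++ [seq i <- t | i \notin s]).
  apply: uniq_perm => //.
    rewrite cat_uniq us filter_uniq// andbT/=.
    by apply/hasPn => i; rewrite mem_filter => /andP[].
  move=> i; rewrite mem_cat mem_filter.
  by case: (boolP (i \in s)) => //= /st.
by rewrite (perm_big _ pt) big_cat/= lerDl sumr_ge0.
Qed.

Lemma cauchy_schwarz_le1 (I : Type) (s : seq I) (a b : I -> R) (T : R) :
  0 <= T -> \sum_(i <- s) a i ^+ 2 <= 1 -> \sum_(i <- s) b i ^+ 2 <= T ^+ 2 ->
  \sum_(i <- s) a i * b i <= T.
Proof.
(* [t] is positive even if T = 0, which makes the weighted inequality a b <= (t / 2) a^2 + b^2 / (2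
   t) meaningful. *)
move=> T0 a1 b1; apply/ler_addgt0Pr => e e0; set t := T + e.
have t0 : 0 < t by rewrite ltr_wpDl.
have bt : \sum_(i <- s) b i ^+ 2 <= t ^+ 2.
  by rewrite (le_trans b1)// ler_sqr ?nnegrE// ?ltW// ?ltrDl// ltW.
apply: (@le_trans _ _ (\sum_(i <- s) (t / 2 * a i ^+ 2 + (2 * t)^-1 * b i ^+ 2))).
  apply: ler_sum => i _; rewrite -subr_ge0.
  rewrite (_ : _ - _ = (t * a i - b i) ^+ 2 / (2 * t)).
    by rewrite divr_ge0 ?sqr_ge0// mulr_ge0// ltW.
  by field; rewrite gt_eqF.
rewrite big_split/= -!mulr_sumr.
apply: (@le_trans _ _ (t / 2 * 1 + (2 * t)^-1 * t ^+ 2)).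
  rewrite lerD// ler_wpM2l//; first by rewrite divr_ge0// ltW.
  by rewrite invr_ge0 mulr_ge0// ltW.
by rewrite le_eqVlt; apply/orP; left; apply/eqP; field; rewrite gt_eqF.
Qed.

End Scalars.

(** * Pull-back of the Kalton-Peck extension *)

Section Twist.
Variables (R : realType) (k : scalar_kind).
Local Notation K := (scalar_field R k).
Local Notation ofr := (@ofr R k).

(** Operators into ell^2 of norm at most 1/2, expressed by finite partial sums. The factor 1/2 gives
    [kp_section] norm at most |e|, so that the quotient norm comes out exactly. *)
Record half_ell2_op (E : normedModType K) := HalfEll2Op {
  half_op :> {linear E -> (nat -> K)};
  half_op_bound : forall e s, uniq s ->
    \sum_(j <- s) absr (half_op e j) ^+ 2 <= (rnorm e / 2) ^+ 2 }.

Definition kp_test (s : seq nat) (y : nat -> K) : bool :=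
  uniq s && (\sum_(j <- s) absr (y j) ^+ 2 <= 1).

Variables (E : completeNormedModType K) (A : half_ell2_op E).

(** The logarithm is taken of the test vector y, so the pairing is linear in z and its supremum
    obeys the triangle inequality, unlike the usual Kalton-Peck quasi-norm. Where y_j = 0 the
    default value of the logarithm is multiplied by 0. *)
Definition kp_pair (s : seq nat) (y : nat -> K) (z : (nat -> K) * E) : K :=
  \sum_(j <- s) y j * (z.1 j - ofr (ln (absr (y j))) * A z.2 j).

Lemma half_op_coord e j : absr (A e j) <= rnorm e.
Proof.
have := @half_op_bound _ A e [:: j] isT; rewrite big_seq1 => h.
have : absr (A e j) <= rnorm e / 2.
  by rewrite -ler_sqr ?nnegrE ?absr_ge0 ?divr_ge0 ?rnorm_ge0.
move=> /le_trans; apply; rewrite ler_pdivrMr// mulr2n mulrDr mulr1 lerDl.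
exact: rnorm_ge0.
Qed.

Lemma kp_pair_linear s y a z w :
  kp_pair s y (a *: z + w) = a * kp_pair s y z + kp_pair s y w.
Proof.
rewrite /kp_pair mulr_sumr -big_split; apply: eq_bigr => j _ /=.
rewrite linearP/= !fctE /GRing.scale/=; ring.
Qed.

Lemma kp_pairB s y z w : kp_pair s y (z - w) = kp_pair s y z - kp_pair s y w.
Proof. by rewrite addrC -scaleN1r kp_pair_linear mulN1r addrC. Qed.

Definition kp_bounded : {pred ((nat -> K) * E)} := fun z =>
  `[< exists M, forall s y, kp_test s y -> absr (kp_pair s y z) <= M >].

Fact kp_bounded_submod : GRing.submod_closed kp_bounded.
Proof.
split=> [|a z w /asboolP[M zM] /asboolP[N wN]]; apply/asboolP.
  exists 0 => s y _; have -> : 0 = 0 - 0 :> (nat -> K) * E by rewrite subrr.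
  by rewrite kp_pairB subrr absr0.
exists (absr a * M + N) => s y sy; rewrite kp_pair_linear.
by rewrite (le_trans (absrD _ _))// absrM lerD ?wN// ler_wpM2l ?absr_ge0 ?zM.
Qed.

HB.instance Definition _ :=
  GRing.isSubmodClosed.Build K ((nat -> K) * E)%type kp_bounded kp_bounded_submod.

Definition kp_norm (z : (nat -> K) * E) : R :=
  sup [set r | exists s y, kp_test s y /\
                           r = Num.max (rnorm z.2) (absr (kp_pair s y z))].

Lemma kp_norm_le z M : rnorm z.2 <= M ->
  (forall s y, kp_test s y -> absr (kp_pair s y z) <= M) -> kp_norm z <= M.
Proof.
move=> z2 zM; apply: ge_sup.
  exists (Num.max (rnorm z.2) (absr (kp_pair [::] (fun=> 0) z))).
  by exists [::], (fun=> 0); rewrite /kp_test big_nil ler01.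
by move=> _ [s [y [sy ->]]]; rewrite ge_max z2 zM.
Qed.

Lemma kp_norm_ub z s y : z \in kp_bounded -> kp_test s y ->
  Num.max (rnorm z.2) (absr (kp_pair s y z)) <= kp_norm z.
Proof.
move=> /asboolP[M zM] sy; apply: sup_upper_bound; last by exists s, y.
split; first by exists (Num.max (rnorm z.2) (absr (kp_pair s y z))), s, y.
exists (Num.max (rnorm z.2) M) => _ [t [x [tx ->]]].
by rewrite ge_max !le_max lexx/= zM// orbT.
Qed.

Lemma kp_test_nil : kp_test [::] (fun=> 0).
Proof. by rewrite /kp_test big_nil ler01. Qed.

Lemma kp_test1 j : kp_test [:: j] (fun=> 1).
Proof. by rewrite /kp_test big_seq1 absr1 expr1n lexx. Qed.

Lemma kp_norm_pair z s y : z \in kp_bounded -> kp_test s y ->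
  absr (kp_pair s y z) <= kp_norm z.
Proof. by move=> zb /(kp_norm_ub zb); rewrite ge_max => /andP[]. Qed.

Lemma kp_norm_snd z : z \in kp_bounded -> rnorm z.2 <= kp_norm z.
Proof. by move=> zb; have := kp_norm_ub zb kp_test_nil; rewrite ge_max => /andP[]. Qed.

Lemma kp_norm_coord z j : z \in kp_bounded -> absr (z.1 j) <= kp_norm z.
Proof.
move=> zb; have := kp_norm_pair zb (kp_test1 j).
by rewrite /kp_pair big_seq1 absr1 ln1 ofr0 mul0r subr0 mul1r.
Qed.

Record twist := Twist { twist_val :> (nat -> K) * E; _ : twist_val \in kp_bounded }.

HB.instance Definition _ := [isSub for twist_val].
HB.instance Definition _ := [Choice of twist by <:].
HB.instance Definition _ := [SubChoice_isSubLmodule of twist by <:].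

Lemma twistP (z : twist) : (z : (nat -> K) * E) \in kp_bounded.
Proof. by case: z. Qed.

Definition twist_norm (z : twist) : K := ofr (kp_norm z).

Fact twist_normD z w : twist_norm (z + w) <= twist_norm z + twist_norm w.
Proof.
rewrite -ofrD ler_ofr; apply: kp_norm_le => [|s y sy].
  by rewrite (le_trans (rnormD _ _))// lerD// kp_norm_snd// twistP.
have -> : (z + w : twist) = 1 *: (z : (nat -> K) * E) + w :> (nat -> K) * E.
  by rewrite scale1r.
rewrite kp_pair_linear mul1r (le_trans (absrD _ _))//.
by rewrite lerD// kp_norm_pair// twistP.
Qed.

Fact twist_normZ (a : K) z : twist_norm (a *: z) = `|a| * twist_norm z.
Proof.
have le b (w : twist) : kp_norm (b *: w : twist) <= absr b * kp_norm w.
  apply: kp_norm_le => [|s y sy].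
    by rewrite /= rnormZ ler_wpM2l ?absr_ge0// kp_norm_snd// twistP.
  have -> : (b *: w : twist) = b *: (w : (nat -> K) * E) + 0 :> (nat -> K) * E.
    by rewrite addr0.
  rewrite kp_pair_linear (_ : kp_pair s y 0 = 0) ?addr0; last first.
    by rewrite -(subrr 0) kp_pairB subrr.
  by rewrite absrM ler_wpM2l ?absr_ge0// kp_norm_pair// twistP.
rewrite -ofr_absr -ofrM; congr ofr; apply/le_anti; rewrite le//=.
(* The reverse inequality is the one just proved, applied to a^-1 and a z. *)
have [->|a0] := eqVneq a 0.
  rewrite absr0 mul0r; apply: le_trans (kp_norm_snd (twistP (0 *: z))).
  exact: rnorm_ge0.
have a0' : 0 < absr a.
  by rewrite lt_neqAle absr_ge0 andbT eq_sym; apply: contra a0 => /eqP/absr_eq0 ->.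
rewrite mulrC -ler_pdivlMr// mulrC -absrV.
by rewrite (le_trans _ (le a^-1 (a *: z)))// scalerA mulVf// scale1r.
Qed.

Fact twist_norm_eq0 z : twist_norm z = 0 -> z = 0.
Proof.
rewrite -(ofr0 R k) => /ofr_inj z0; apply: val_inj.
have z2 : (val z).2 = 0.
  by apply/rnorm_eq0/le_anti; rewrite rnorm_ge0 andbT -z0 kp_norm_snd// twistP.
have z1 : (val z).1 = 0.
  apply/funext => j; apply/absr_eq0/le_anti; rewrite absr_ge0 andbT -z0.
  by rewrite kp_norm_coord// twistP.
by move: z1 z2; case: (val z) => u v /= -> ->.
Qed.

HB.instance Definition _ :=
  Lmodule_isNormed.Build K twist twist_normD twist_normZ twist_norm_eq0.

Lemma rnorm_twist (z : twist) : rnorm z = kp_norm z.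
Proof. by apply: (@ofr_inj R k); rewrite ofr_norm_absr. Qed.

(** A pairing involves finitely many coordinates, so it is continuous for coordinatewise convergence
    joined to convergence in E. The constant [c] keeps the contribution of each new coordinate at
    most d / 2. *)
Lemma kp_pair_near (F : set_system twist) (FF : ProperFilter F)
    (l : (nat -> K) * E) s y :
  (forall j d, 0 < d -> \forall x \near F, absr ((val (x : twist)).1 j - l.1 j) < d) ->
  (forall d, 0 < d -> \forall x \near F, rnorm ((val (x : twist)).2 - l.2) < d) ->
  forall d, 0 < d -> \forall x \near F, absr (kp_pair s y (val (x : twist) - l)) < d.
Proof.
move=> fl1 fl2; elim: s => [|j s ih] d d0.
  by apply: nearW => x; rewrite /kp_pair big_nil absr0.
pose Y := absr (y j); pose L := `|ln Y|; pose c := 1 + Y * (1 + L).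
have d2 : 0 < d / 2 by rewrite divr_gt0.
have Y0 : 0 <= Y := absr_ge0 _.
have L0 : 0 <= L := normr_ge0 _.
have c0 : 0 < c by rewrite ltr_pwDl// mulr_ge0// addr_ge0.
have dc : 0 < d / 2 / c by rewrite divr_gt0.
near=> x.
have h1 : absr (kp_pair s y (val x - l)) < d / 2 by near: x; exact: ih.
have h2 : absr ((val x).1 j - l.1 j) < d / 2 / c by near: x; exact: fl1.
have h3 : rnorm ((val x).2 - l.2) < d / 2 / c by near: x; exact: fl2.
rewrite /kp_pair big_cons -/(kp_pair s y (val x - l)).
rewrite (le_lt_trans (absrD _ _))// [ltRHS]splitr ler_ltD// absrM -/Y.
apply: (@le_trans _ _ (Y * (d / 2 / c + L * (d / 2 / c)))); last first.
  rewrite -[leRHS](divfK (lt0r_neq0 c0)).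
  by rewrite -subr_ge0 (_ : _ - _ = d / 2 / c) ?ltW// [in LHS]/c; ring.
rewrite ler_wpM2l// (le_trans (absrD _ _))// absrN absrM absr_ofr lerD ?(ltW h2)//.
by rewrite ler_wpM2l// (le_trans (half_op_coord _ _))// ltW.
Unshelve. all: by end_near. Qed.

Fact twist_complete (F : set_system twist) : ProperFilter F -> cauchy F -> cvg F.
Proof.
move=> FF /cauchy_ballP cF.
have cF2 (e : R) : 0 < e -> exists2 B : set twist, F B &
    forall x y, B x -> B y -> kp_norm (x - y : twist) < e.
  move=> e0; have := cF (ofr e); rewrite -(ofr0 R k) ltr_ofr => /(_ e0).
  case=> -[B C] /= [FB FC] BC; exists (B `&` C); first exact: filterI.
  move=> x y [Bx _] [_ Cy].
  have := BC (x, y) (conj Bx Cy); rewrite -ball_normE /ball_/=.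
  by rewrite -ofr_norm_absr ltr_ofr rnorm_twist.
have bd (x y : twist) : val x - val y \in kp_bounded := twistP (x - y).
have /choice[l hl] j : exists l, forall e : R, 0 < e ->
    \forall x \near F, absr ((val (x : twist)).1 j - l) < e.
  apply: scalar_cauchy => e e0; have [B FB hB] := cF2 _ e0.
  have [x Bx] := filter_ex FB; exists x.
  apply: filterS FB => y By; apply: le_lt_trans (hB x y Bx By).
  exact: (kp_norm_coord j (bd x y)).
have [v hv] : exists v, forall e : R, 0 < e ->
    \forall x \near F, rnorm ((val (x : twist)).2 - v) < e.
  have cE : cauchy ((fun x : twist => (val x).2) @ F).
    apply: cauchy_exP => e /ofr_pos[d d0 ->]; have [B FB hB] := cF2 _ d0.
    have [x Bx] := filter_ex FB; exists (val x).2.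
    suff : F [set y : twist | ball (val x).2 (ofr d) (val y).2] by [].
    apply: filterS FB => y By; rewrite -ball_normE /ball_/=.
    rewrite -ofr_norm_absr ltr_ofr (le_lt_trans _ (hB x y Bx By))//.
    exact: (kp_norm_snd (bd x y)).
  have /cvg_ex[v /cvgrPdist_lt vl] : cvg ((fun x : twist => (val x).2) @ F).
    exact: cauchy_cvg.
  exists v => e e0; have := vl (ofr e); rewrite -{1}(ofr0 R k) ltr_ofr => /(_ e0).
  apply: filterS => x /=; rewrite -ofr_norm_absr ltr_ofr.
  by rewrite -rnormN opprB.
(* Lower semicontinuity: the Cauchy bound between x and w survives the limit in w for each fixed
   test, hence holds uniformly over all tests. *)
have key (e : R) : 0 < e -> \forall x \near F,
    rnorm ((val (x : twist)).2 - v) <= e /\ forall s y, kp_test s y ->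
    absr (kp_pair s y (val x - (l, v))) <= e.
  move=> e0; have [B FB hB] := cF2 _ e0; apply: filterS (FB) => x Bx.
  split=> [|s y sy]; apply/ler_addgt0Pr => d d0.
    have [w [Bw wv]] : exists w, B w /\ rnorm ((val (w : twist)).2 - v) < d.
      by apply: (@filter_ex _ F); apply: filterI => //; exact: hv.
    have -> : (val x).2 - v = ((val x).2 - (val w).2) + ((val w).2 - v).
      by rewrite addrA subrK.
    rewrite (le_trans (rnormD _ _))// lerD// ltW//.
    by apply: le_lt_trans (hB x w Bx Bw); exact: (kp_norm_snd (bd x w)).
  have [w [Bw wv]] : exists w, B w /\
      absr (kp_pair s y (val (w : twist) - (l, v))) < d.
    apply: (@filter_ex _ F); apply: filterI => //.
    exact: (@kp_pair_near F FF (l, v)).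
  have -> : kp_pair s y (val x - (l, v)) =
      kp_pair s y (val x - val w) + kp_pair s y (val w - (l, v)).
    by rewrite !kp_pairB addrA subrK.
  rewrite (le_trans (absrD _ _))// lerD// ?(ltW wv)//.
  by rewrite ltW// (le_lt_trans _ (hB x w Bx Bw))// kp_norm_pair.
have [x0 [_ hx0]] := filter_ex (key 1 ltr01).
have lv : (l, v) \in kp_bounded.
  have -> : (l, v) = val x0 - (val x0 - (l, v)) by rewrite opprB addrC subrK.
  by rewrite rpredB ?twistP//; apply/asboolP; exists 1.
apply/cvg_ex; exists (Twist lv); apply/cvgrPdist_le => e /ofr_pos[d d0 ->].
apply: filterS (key _ d0) => x [h1 h2].
by rewrite distrC -ofr_norm_absr ler_ofr rnorm_twist kp_norm_le.
Qed.

HB.instance Definition _ := Uniform_isComplete.Build twist twist_complete.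

Definition kp_section (e : E) : nat -> K :=
  fun j => A e j * ofr (ln (absr (A e j) / (rnorm e / 2))).

(** With h = |e| / 2 the j-th term is y_j (A e)_j (ln (|(A e)_j| / h) - ln |y_j|). By
    [ln_ratio_bound] it is at most h times a sum of two squares, and each of the two families of
    squares sums to at most 1. *)
Lemma kp_section_pair s y e : kp_test s y ->
  absr (kp_pair s y (kp_section e, e)) <= rnorm e.
Proof.
move=> /andP[us y1]; have [e0|en0] := eqVneq (rnorm e) 0.
  rewrite (rnorm_eq0 e0) rnorm0 /kp_pair/= big1 ?absr0// => j _.
  by rewrite /kp_section linear0 /= mul0r mulr0 subrr mulr0.
pose h := rnorm e / 2.
have h0 : 0 < h by rewrite divr_gt0// lt_neqAle eq_sym en0 rnorm_ge0.
apply: (le_trans (absr_sum _ _ _)).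
apply: (@le_trans _ _ (\sum_(j <- s) h * ((absr (A e j) / h) ^+ 2 + absr (y j) ^+ 2))).
  apply: ler_sum => j _; rewrite /kp_section /= -/h.
  have -> : A e j * ofr (ln (absr (A e j) / h)) - ofr (ln (absr (y j))) * A e j =
      A e j * ofr (ln (absr (A e j) / h) - ln (absr (y j))).
    by rewrite ofrD ofrN mulrBr [ofr (ln (absr (y j))) * _]mulrC.
  rewrite !absrM absr_ofr.
  have := @ln_ratio_bound R (absr (A e j) / h) (absr (y j)).
  rewrite divr_ge0 ?absr_ge0 ?(ltW h0)// => /(_ isT isT).
  move=> hle; apply: le_trans (ler_wpM2l (ltW h0) hle).
  rewrite le_eqVlt; apply/orP; left; apply/eqP; field; exact: lt0r_neq0.
rewrite -mulr_sumr big_split/=.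
under [X in X + _]eq_bigr do rewrite expr_div_n.
rewrite -mulr_suml (@le_trans _ _ (h * (1 + 1)))//; last first.
  by rewrite le_eqVlt; apply/orP; left; apply/eqP; rewrite /h; field.
rewrite ler_wpM2l ?(ltW h0)// lerD// ler_pdivrMr ?exprn_gt0// mul1r.
exact: half_op_bound.
Qed.

Lemma kp_section_bounded e : (kp_section e, e) \in kp_bounded.
Proof. by apply/asboolP; exists (rnorm e) => s y; exact: kp_section_pair. Qed.

Lemma rnorm_kp_section e : rnorm (Twist (kp_section_bounded e)) <= rnorm e.
Proof. by rewrite rnorm_twist kp_norm_le// => s y; exact: kp_section_pair. Qed.

Lemma ell2_sum_le (x : ell2 R k) s : uniq s ->
  \sum_(j <- s) absr (x j) ^+ 2 <= rnorm x ^+ 2.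
Proof.
move=> us; rewrite rnorm_ell2.
have nd : nondecreasing_seq (sqsum x).
  by apply: nondecreasing_series => n _ _; rewrite exprn_ge0// absr_ge0.
have cx : cvgn (sqsum x) by case: x {nd} => x /= /asboolP.
have x0 n : 0 <= sqsum x n by apply: sumr_ge0 => i _; rewrite exprn_ge0// absr_ge0.
have le n : sqsum x n <= limn (sqsum x) by exact: nondecreasing_cvgn_le.
rewrite sqr_sqrtr; last exact: le_trans (x0 0) (le 0).
(* The initial segment up to the largest element of s contains s. *)
apply: (le_trans _ (le (\max_(j <- s) j).+1)); rewrite /sqsum /series/=.
apply: (ler_sum_uniq us (iota_uniq _ _)) => [j js|j]; last exact: sqr_ge0.
by rewrite mem_iota/= add0n subn0 ltnS leq_bigmax_seq.
Qed.

(** Converse of Cauchy-Schwarz: the logarithmic term vanishes on pairs with zero second entry, and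
    the optimal test recovers the ell^2 norm on s. *)
Lemma kp_dual s (x : nat -> K) M : uniq s -> 0 <= M ->
  (forall y, kp_test s y -> absr (kp_pair s y (x, 0)) <= M) ->
  \sum_(j <- s) absr (x j) ^+ 2 <= M ^+ 2.
Proof.
move=> us M0 hM; set S := \sum_(j <- s) _.
have S0 : 0 <= S by apply: sumr_ge0 => j _; exact: sqr_ge0.
have [->|Sn0] := eqVneq S 0; first exact: sqr_ge0.
pose r := Num.sqrt S; have rS : r ^+ 2 = S by rewrite sqr_sqrtr.
have r0 : 0 < r by rewrite sqrtr_gt0 lt_neqAle eq_sym Sn0.
(* This is the conjugate of x_j divided by r, written without conjugation; where x_j = 0 the
   convention 0^-1 = 0 gives y_j = 0. *)
pose y j := ofr (absr (x j) ^+ 2 / r) / x j.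
have absy j : absr (y j) = absr (x j) / r.
  rewrite /y absrM absr_ofr absrV ger0_norm ?divr_ge0 ?sqr_ge0 ?(ltW r0)//.
  have [->|x0] := eqVneq (absr (x j)) 0; first by rewrite invr0 mulr0 mul0r.
  by field; rewrite x0 gt_eqF.
have /hM : kp_test s y.
  rewrite /kp_test us/=; under eq_bigr do rewrite absy expr_div_n.
  by rewrite -mulr_suml -/S rS divff.
have -> : kp_pair s y (x, 0) = ofr r.
  rewrite -[r](mulfK (lt0r_neq0 r0)) -expr2 rS mulr_suml ofr_sum.
  apply: eq_bigr => j _; rewrite linear0/= mulr0 subr0 /y.
  have [->|x0] := eqVneq (x j) 0; last by rewrite divfK.
  by rewrite mulr0 absr0 expr0n mul0r ofr0.
by rewrite absr_ofr gtr0_norm// -rS ler_sqr ?nnegrE// ltW.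
Qed.

Lemma kp_pair_ell2 (x : ell2 R k) s y : kp_test s y ->
  absr (kp_pair s y (x : nat -> K, 0)) <= rnorm x.
Proof.
move=> /andP[us y1]; rewrite /kp_pair; apply: (le_trans (absr_sum _ _ _)).
under eq_bigr do rewrite linear0/= mulr0 subr0 absrM.
by apply: cauchy_schwarz_le1; rewrite ?rnorm_ge0// ell2_sum_le.
Qed.

Lemma ell2_bounded (x : ell2 R k) : (x : nat -> K, 0 : E) \in kp_bounded.
Proof. by apply/asboolP; exists (rnorm x) => s y; exact: kp_pair_ell2. Qed.

Definition twist_inj_fun (x : ell2 R k) : twist := Twist (ell2_bounded x).

Fact twist_inj_linear : linear twist_inj_fun.
Proof.
by move=> a x y; apply: val_inj; congr pair => /=; rewrite scaler0 addr0.
Qed.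

Definition twist_inj : {linear ell2 R k -> twist} := mklin twist_inj_linear.

Definition twist_proj_fun (z : twist) : E := (val z).2.

Fact twist_proj_linear : linear twist_proj_fun.
Proof. by []. Qed.

Definition twist_proj : {linear twist -> E} := mklin twist_proj_linear.

Lemma rnorm_twist_proj z : rnorm (twist_proj z) <= rnorm z.
Proof. by rewrite rnorm_twist kp_norm_snd// twistP. Qed.

Lemma twisted_sum_twist : twisted_sum twist_inj twist_proj.
Proof.
split.
- move=> x; apply/le_anti/andP; split.
    rewrite rnorm_twist kp_norm_le//= ?rnorm0 ?rnorm_ge0// => s y.
    exact: kp_pair_ell2.
  rewrite [leLHS]rnorm_ell2 -[leRHS]ger0_norm ?rnorm_ge0// -sqrtr_sqr ler_wsqrtr//.
  apply: limr_le; first by case: x => x /= /asboolP.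
  apply: nearW => n; apply: kp_dual; rewrite ?iota_uniq ?rnorm_ge0// => y sy.
  by rewrite rnorm_twist; apply: kp_norm_pair sy; exact: ell2_bounded.
- split.
  + apply: (@le_lt_trans _ _ 1%:E); last exact: ltry.
    apply: ge_ereal_sup => _ [z [_ z1] <-]; rewrite lee_fin.
    exact: le_trans (rnorm_twist_proj z) z1.
  + by move=> e; exists (Twist (kp_section_bounded e)).
  + move=> z; rewrite /quotient_norm; apply/le_anti/andP; split.
      apply: lb_le_inf; first by exists (rnorm (z + 0)), 0 => //; exact: linear0.
      move=> _ [u u0 <-]; apply: le_trans (rnorm_twist_proj _).
      have {}u0 : twist_proj u = 0 := u0.
      by rewrite linearD u0 addr0.
    (* The nonlinear selection [w] over [e] lies in the coset of z and has norm at most |e|, so it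
       witnesses the bound on the infimum. *)
    pose e := twist_proj z; pose w := Twist (kp_section_bounded e).
    apply: (le_trans _ (rnorm_kp_section e)); apply: ge_inf.
      by exists 0 => _ [u _ <-]; exact: rnorm_ge0.
    exists (w - z); last by rewrite addrC subrK.
    have -> : [set u | twist_proj u = 0] (w - z) = (twist_proj w - twist_proj z = 0).
      by rewrite -linearB.
    exact: subrr.
- apply/seteqP; split => [_ [x _ <-]//|z /= z0].
  have zE : ((val z).1, 0) = val z.
    by have : (val z).2 = 0 := z0; case: (val z) => u v /= ->.
  (* On the kernel, [kp_dual] with M the norm of z bounds all partial sums of squares. *)
  have xs : (val z).1 \in @square_summable R k.
    apply/asboolP; apply: nondecreasing_is_cvgn.
      by apply: nondecreasing_series => n _ _; rewrite exprn_ge0// absr_ge0.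
    exists (rnorm z ^+ 2) => _ [n _ <-]; apply: kp_dual.
    + by rewrite iota_uniq.
    + exact: rnorm_ge0.
    + by move=> y sy; rewrite rnorm_twist zE; apply: kp_norm_pair sy; exact: twistP.
  by exists (Ell2 xs) => //; apply: val_inj; exact: zE.
Qed.

(** A lifting has the form e |-> (L e, e), and M is its operator norm. *)
Lemma splits_twist : splits twist_proj ->
  exists L : {linear E -> (nat -> K)}, exists M : R, forall e s y, kp_test s y ->
    absr (kp_pair s y (L e, e)) <= M * rnorm e.
Proof.
move=> [v [bv qv]].
have Ll : linear (fun e => (val (v e)).1) by move=> a x y; rewrite linearP.
exists (mklin Ll).
have [M vM] : exists M, forall e, rnorm (v e) <= M * rnorm e.
  have : op_norm predT (@rnorm R k E) (@rnorm R k twist) v \is a fin_num.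
    rewrite fin_numElt bv andbT (lt_le_trans (ltNyr 0))//.
    apply: ereal_sup_ubound; exists 0; last by rewrite linear0 rnorm0.
    by split => //; rewrite rnorm0.
  move=> /fineK; set M := fine _ => vM; exists M => e.
  have [e0|en0] := eqVneq (rnorm e) 0.
    by rewrite (rnorm_eq0 e0) linear0 !rnorm0 mulr0.
  have e0 : 0 < rnorm e by rewrite lt_neqAle eq_sym en0 rnorm_ge0.
  have : ((rnorm (v (ofr (rnorm e)^-1 *: e)))%:E <= M%:E)%E.
    rewrite vM; apply: ereal_sup_ubound; exists (ofr (rnorm e)^-1 *: e) => //.
    split => //; rewrite rnormZ absr_ofr ger0_norm ?invr_ge0 ?rnorm_ge0//.
    by rewrite mulVf.
  rewrite lee_fin linearZ/= rnormZ absr_ofr ger0_norm ?invr_ge0 ?rnorm_ge0//.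
  by rewrite mulrC ler_pdivrMr.
exists M => e s y sy; apply: le_trans (vM e).
have -> : (mklin Ll e, e) = val (v e).
  have ve : (val (v e)).2 = e := qv e.
  by transitivity ((val (v e)).1, (val (v e)).2); [rewrite ve | case: (val (v e))].
by rewrite rnorm_twist kp_norm_pair// twistP.
Qed.

End Twist.

(** * Rademacher coefficients and non-splitting *)

Section Blocks.
Variables (R : realType) (k : scalar_kind).
Local Notation K := (scalar_field R k).
Local Notation ofr := (@ofr R k).

Definition cube n := {ffun 'I_n -> bool}.

(** Fourier coefficient at the i-th coordinate character; [true] encodes the sign -1. *)
Definition rad_coef n (x : cube n -> K) (i : 'I_n) : K :=
  ofr (2 ^- n) * \sum_(e : cube n) (-1) ^+ e i * x e.

(** Multiplication of signs, that is, translation in the group {-1,1}^n. *)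
Definition cube_xor n (e f : cube n) : cube n := [ffun i => e i (+) f i].

Lemma cube_xorK n (f : cube n) : involutive (cube_xor f).
Proof. by move=> e; apply/ffunP => i; rewrite !ffunE addKb. Qed.

Lemma cube_xorC n : commutative (@cube_xor n).
Proof. by move=> e f; apply/ffunP => i; rewrite !ffunE addbC. Qed.

Lemma sum_cube_xor n (X : cube n -> K) (f : cube n) i :
  \sum_(e : cube n) (-1) ^+ e i * X (cube_xor f e) =
  (-1) ^+ f i * \sum_(e : cube n) (-1) ^+ e i * X e.
Proof.
rewrite (reindex_inj (inv_inj (cube_xorK f))) mulr_sumr; apply: eq_bigr => e _.
by rewrite cube_xorK ffunE signr_addb mulrA.
Qed.

Variables (E : completeNormedModType K) (A : half_ell2_op E).

(** On the translate by f of the Riesz product, a suitable pairing equals [S f] + c ln N / 2.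
    Summing over f turns the [S f] into diagonal coefficients of L at the Rademacher functions,
    which are bounded by |M| C, so the logarithm must be bounded too. The sign of M is unknown,
    hence |M|. *)
Lemma kp_block_bound (L : {linear E -> (nat -> K)}) (M : R) n
    (idx : 'I_n.+1 -> nat) (inv : nat -> 'I_n.+1)
    (V : {linear (cube n.+1 -> K) -> E}) (c C : R) :
  (forall e s y, kp_test s y -> absr (kp_pair A s y (L e, e)) <= M * rnorm e) ->
  cancel idx inv -> 0 <= c ->
  (forall x, (forall e, absr (x e) <= 1) -> rnorm (V x) <= C) ->
  (forall x i, A (V x) (idx i) = ofr c * rad_coef x i) ->
  c * ln n.+1%:R <= 2 * (`|M| * C * (expR 1 + 1)).
Proof.
move=> hL idxK c0 VC AV; set N : R := n.+1%:R.
have N0 : 0 < N by rewrite ltr0n.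
pose t := (Num.sqrt N)^-1; have t0 : 0 < t by rewrite invr_gt0 sqrtr_gt0.
have t2 : t ^+ 2 = N^-1 by rewrite exprVn sqr_sqrtr// ltW.
have lnt : ln t = - (ln N / 2).
  have : ln (t ^+ 2) = - ln N by rewrite t2 lnV.
  by rewrite lnXn// -mulr_natr => h; rewrite -[ln N]opprK -h; field.
have [X X1 Xr] := @riesz_product R n.
pose P : R := 2 ^+ n.+1; have P0 : 0 < P by rewrite exprn_gt0.
have XrK i : \sum_(e : cube n.+1) (-1) ^+ e i * ofr (X e) = ofr (P * t).
  rewrite -(Xr i) ofr_sum; apply: eq_bigr => e _; rewrite ofrM; congr (_ * _).
  by case: (e i); rewrite ?expr1 ?expr0 ?ofrN ofr1.
pose r (i : 'I_n.+1) (e : cube n.+1) : K := (-1) ^+ e i.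
pose x (f e : cube n.+1) : K := ofr (X (cube_xor f e)).
have hL' e s y B : kp_test s y -> rnorm e <= B -> absr (kp_pair A s y (L e, e)) <= `|M| * B.
  move=> sy eB; apply: (le_trans (hL e s y sy)).
  apply: (@le_trans _ _ (`|M| * rnorm e)); last by rewrite ler_wpM2l.
  by rewrite ler_wpM2r ?rnorm_ge0// ler_norm.
(* For a single weight 1 the logarithm vanishes and the pairing is a coordinate of L. *)
have d i : absr (L (V (r i)) (idx i)) <= `|M| * C.
  have := @hL' (V (r i)) [:: idx i] (fun=> 1) C (@kp_test1 R k _).
  rewrite /kp_pair big_seq1 absr1 ln1 ofr0 mul0r subr0 mul1r; apply.
  by apply: VC => e; rewrite absr_sign.
have xC f : rnorm (V (x f)) <= expR 1 * C.
  have e0 : 0 < expR 1 :> R by exact: expR_gt0.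
  have -> : x f = ofr (expR 1) *: (fun e => ofr (X (cube_xor f e) / expR 1) : K).
    apply/funext => e; rewrite /x -[in LHS](divfK (lt0r_neq0 e0) (X _)) mulrC.
    by rewrite ofrM.
  rewrite linearZ/= rnormZ absr_ofr gtr0_norm// ler_pM2l//; apply: VC => e.
  by rewrite absr_ofr normrM normfV (gtr0_norm e0) ler_pdivrMr// mul1r.
have rad_coefx f i : rad_coef (x f) i = (-1) ^+ f i * ofr t.
  rewrite /rad_coef /x (sum_cube_xor (fun e => ofr (X e))) XrK mulrCA -ofrM; congr (_ * ofr _).
  by rewrite mulrA mulVf ?mul1r// lt0r_neq0.
pose S (f : cube n.+1) : K := \sum_(i < n.+1) (-1) ^+ f i * ofr t * L (V (x f)) (idx i).
have Sb f : absr (S f + ofr (c * ln N / 2)) <= `|M| * (expR 1 * C).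
  (* All N = n + 1 weights have modulus t = N^(-1/2), so this is a unit vector, and its signs match
     the coefficients of [x f]. Since - ln t = ln N / 2, the twisting term consists of N equal
     contributions t^2 c ln N / 2. *)
  pose y j : K := (-1) ^+ (f : cube n.+1) (inv j) * ofr t.
  have absy j : absr (y j) = t by rewrite absrM absr_sign mul1r absr_ofr gtr0_norm.
  pose s := [seq idx i | i <- enum 'I_n.+1].
  have sy : kp_test s y.
    rewrite /kp_test map_inj_uniq ?enum_uniq/=; last exact: can_inj idxK.
    under eq_bigr do rewrite absy t2.
    rewrite big_map big_enum/= sumr_const card_ord -mulr_natl mulfV//.
  have := hL' _ _ _ _ sy (xC f).
  suff -> : kp_pair A s y (L (V (x f)), V (x f)) = S f + ofr (c * ln N / 2) by [].
  rewrite /kp_pair big_map big_enum/= /S.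
  have -> : ofr (c * ln N / 2) = \sum_(i < n.+1) ofr (t ^+ 2 * (c * ln N / 2)).
    rewrite -ofr_sum sumr_const card_ord; congr ofr.
    transitivity (N * (t ^+ 2 * (c * ln N / 2))); last by rewrite mulr_natl.
    by rewrite t2 mulVKf// lt0r_neq0.
  rewrite -big_split; apply: eq_bigr => i _.
  rewrite absy AV rad_coefx /y idxK lnt ofrN mulNr opprK mulrDr; congr (_ + _).
  have -> : (-1) ^+ f i * ofr t * (ofr (ln N / 2) * (ofr c * ((-1) ^+ f i * ofr t))) =
    ((-1) ^+ f i * (-1) ^+ f i) * (ofr t * ofr t * (ofr c * ofr (ln N / 2))) by ring.
  by rewrite -expr2 sqrr_sign mul1r -!ofrM; congr ofr; ring.
have LV a w j : L (V (a *: w)) j = a * L (V w) j by rewrite !linearZ.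
have sumS : \sum_f S f = \sum_i ofr (P * t ^+ 2) * L (V (r i)) (idx i).
  rewrite exchange_big; apply: eq_bigr => i _ /=.
  have -> : ofr (P * t ^+ 2) * L (V (r i)) (idx i) =
      ofr t * L (V (ofr (P * t) *: r i)) (idx i).
    by rewrite LV [RHS]mulrA -ofrM; congr (ofr _ * _); ring.
  (* Summing the translates of X against the i-th character leaves only this character, with factor
     P t. *)
  have -> : ofr (P * t) *: r i = \sum_(f : cube n.+1) (-1) ^+ f i *: x f.
    apply/funext => e; rewrite fct_sumE/=.
    transitivity (ofr (P * t) * (-1) ^+ e i : K) => //.
    rewrite -(XrK i) mulrC -(sum_cube_xor (fun e => ofr (X e))).
    by apply: eq_bigr => f _; rewrite cube_xorC.
  rewrite !linear_sum/= fct_sumE mulr_sumr; apply: eq_bigr => f _.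
  by rewrite LV; ring.
have : ofr (P * (c * ln N / 2)) =
    \sum_f (S f + ofr (c * ln N / 2)) - \sum_i ofr (P * t ^+ 2) * L (V (r i)) (idx i).
  rewrite big_split/= sumS addrAC subrr add0r -ofr_sum sumr_const.
  by rewrite card_ffun card_bool card_ord; congr ofr; rewrite -[RHS]mulr_natl natrX.
move=> /(congr1 (@absr R k)); rewrite absr_ofr ger0_norm; last first.
  by rewrite mulr_ge0 ?(ltW P0)// divr_ge0// mulr_ge0// ln_ge0// ler1n.
move=> h; have : P * (c * ln N / 2) <= P * (`|M| * C * (expR 1 + 1)).
  rewrite h (le_trans (absrD _ _))// absrN mulrDr mulr1 mulrDr lerD//.
    rewrite (le_trans (absr_sum _ _ _))//.
    apply: (@le_trans _ _ (\sum_(f : cube n.+1) `|M| * (expR 1 * C))).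
      by apply: ler_sum => f _; exact: Sb.
    rewrite sumr_const card_ffun card_bool card_ord -mulr_natl natrX.
    by rewrite [expR 1 * C]mulrC [`|M| * (C * _)]mulrA.
  rewrite (le_trans (absr_sum _ _ _))//.
  apply: (@le_trans _ _ (\sum_(i < n.+1) (P * t ^+ 2) * (`|M| * C))).
    apply: ler_sum => i _; rewrite absrM absr_ofr gtr0_norm ?mulr_gt0 ?exprn_gt0//.
    by rewrite ler_wpM2l// mulr_ge0// ?exprn_ge0// ltW.
  rewrite sumr_const card_ord -mulr_natl t2 -/N le_eqVlt; apply/orP; left; apply/eqP.
  by field; exact: lt0r_neq0.
by rewrite ler_pM2l// ler_pdivrMr// [leRHS]mulrC.
Qed.

(** The Rademacher map from the sup-normed functions on the cube to ell^2 of dimension n + 1 factors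
    through E, with one constant for all n. *)
Definition cube_factors (C : R) : Prop :=
  forall n, exists (B : {linear E -> ('I_n.+1 -> K)}) (V : {linear (cube n.+1 -> K) -> E}),
  [/\ forall e, \sum_i absr (B e i) ^+ 2 <= (C * rnorm e) ^+ 2,
      forall x, (forall e, absr (x e) <= 1) -> rnorm (V x) <= C &
      forall x i, B (V x) i = rad_coef x i].

End Blocks.

(** * Gluing the blocks into one operator *)

Section Gluing.
Variables (R : realType) (k : scalar_kind).
Local Notation K := (scalar_field R k).
Local Notation ofr := (@ofr R k).

Lemma nat_pairing : exists (f : nat -> nat * nat) (g : nat * nat -> nat),
  cancel f g /\ cancel g f.
Proof.
have /card_set_bijP[g gb] : ([set: nat * nat] #= [set: nat])%card := card_nat2.
have [f gK fK] : bijective g by rewrite -setTT_bijective.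
by exists f, g.
Qed.

Lemma sum_geometric_le1 n : \sum_(0 <= m < n) ((2 ^ m.+1)%N%:R ^- 2 : R) <= 1.
Proof.
(* The summands are 4^-(m + 1); the stronger bound 1 - 4^-n carries the induction. *)
suff : \sum_(0 <= m < n) ((2 ^ m.+1)%N%:R ^- 2 : R) <= 1 - (2 ^ n)%N%:R ^- 2.
  by move=> /le_trans; apply; rewrite lerBlDr lerDl invr_ge0 sqr_ge0.
elim: n => [|n ih]; first by rewrite big_geq// expn0 expr1n invr1 subrr.
rewrite big_nat_recr//= -lerBrDr (le_trans ih)// expnS natrM exprMn [(2%:R ^+ 2 * _)^-1]invfM.
have : 0 <= ((2 ^ n)%N%:R : R) ^- 2 by rewrite invr_ge0 sqr_ge0.
by move: (_ ^- 2) => u u0; lra.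
Qed.

Variable E : completeNormedModType K.

Lemma nonsplit_twist (C : R) : 0 < C -> cube_factors E C ->
  exists A : half_ell2_op E, ~ splits (twist_proj A).
Proof.
move=> C0 hC.
have [f [g [fK gK]]] := nat_pairing.
(* Then (c_m C |e|)^2 = 4^-(m + 1) (|e| / 2)^2, so all blocks together stay within the norm bound
   1/2. *)
pose c m : R := ((2 ^ m.+1)%N%:R * (2 * C))^-1.
have c0 m : 0 < c m by rewrite invr_gt0 !mulr_gt0// ltr0n expn_gt0.
(* Large enough for c_m ln (N_m + 1) >= m in spite of the decay of c_m. *)
pose N m := Num.truncn (expR (m%:R / c m)).
pose B m : {linear E -> ('I_(N m).+1 -> K)} := sval (cid (hC (N m))).
have [V hBV] : exists V : forall m, {linear (cube (N m).+1 -> K) -> E}, forall m,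
  [/\ forall e, \sum_i absr (B m e i) ^+ 2 <= (C * rnorm e) ^+ 2,
      forall x, (forall e, absr (x e) <= 1) -> rnorm (V m x) <= C &
      forall x i, B m (V m x) i = rad_coef x i].
  exists (fun m => sval (cid (svalP (cid (hC (N m)))))) => m.
  exact: svalP (cid (svalP (cid (hC (N m))))).
(* Coordinate j encodes a block and an index in it; positions beyond the size of the block are
   filled with 0. *)
pose Af (e : E) (j : nat) : K :=
  ofr (c (f j).1) * (if ((f j).2 <= N (f j).1)%N then B (f j).1 e (inord (f j).2) else 0).
have Al : linear Af.
  move=> a u v; apply/funext => j; transitivity (a * Af u j + Af v j) => //.
  have lin m i : B m (a *: u + v) i = a * B m u i + B m v i by rewrite linearP.
  by rewrite /Af lin; case: ifP => _; [ring | rewrite !mulr0 addr0].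
have Ab e s : uniq s -> \sum_(j <- s) absr (mklin Al e j) ^+ 2 <= (rnorm e / 2) ^+ 2.
  move=> us.
  pose G (z : nat * nat) : R := (c z.1 * absr (B z.1 e (inord z.2))) ^+ 2.
  pose t := [seq z <- [seq f j | j <- s] | z.2 <= N z.1]%N.
  have -> : \sum_(j <- s) absr (mklin Al e j) ^+ 2 = \sum_(z <- t) G z.
    rewrite big_filter big_map [RHS]big_mkcond/=; apply: eq_bigr => j _.
    rewrite /Af /G absrM absr_ofr (gtr0_norm (c0 _)).
    by case: ifP => // _; rewrite absr0 mulr0 expr0n.
  (* The finite set of coordinates is enlarged to the union of the first [J] full blocks. *)
  pose J := (\max_(z <- t) z.1).+1.
  pose r := [seq (m, i) | m <- iota 0 J, i <- iota 0 (N m).+1].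
  apply: (@le_trans _ _ (\sum_(z <- r) G z)).
    apply: ler_sum_uniq => [||z|z]; last exact: sqr_ge0.
    - by rewrite filter_uniq// map_inj_uniq//; exact: can_inj fK.
    - apply: allpairs_uniq_dep => [|m _|]; rewrite ?iota_uniq//.
      by move=> [m i] [m' i'] _ _ /= [-> ->].
    - move=> zt; have zN : (z.2 <= N z.1)%N by move: zt; rewrite mem_filter => /andP[].
      apply/allpairsPdep; exists z.1, z.2; split; last by case: (z).
        by rewrite mem_iota/= add0n /J ltnS; exact: (@leq_bigmax_seq _ t xpredT fst z).
      by rewrite mem_iota/= add0n ltnS.
  rewrite big_allpairs_dep.
  apply: (@le_trans _ _ (\sum_(m <- iota 0 J) (2 ^ m.+1)%N%:R ^- 2 * (rnorm e / 2) ^+ 2)).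
    apply: ler_sum => m _; rewrite /G/=.
    have -> : \sum_(i <- iota 0 (N m).+1) (c m * absr (B m e (inord i))) ^+ 2 =
        c m ^+ 2 * \sum_i absr (B m e i) ^+ 2.
      have -> : iota 0 (N m).+1 = index_iota 0 (N m).+1 by rewrite /index_iota subn0.
      rewrite big_mkord mulr_sumr; apply: eq_bigr => i _.
      by rewrite exprMn inord_val.
    have [hB _ _] := hBV m.
    apply: (le_trans (ler_wpM2l (sqr_ge0 _) (hB e))).
    rewrite le_eqVlt; apply/orP; left; apply/eqP; rewrite /c; field.
    by rewrite (lt0r_neq0 C0) andbT pnatr_eq0 -lt0n expn_gt0.
  rewrite -mulr_suml ler_piMl ?sqr_ge0//.
  have -> : iota 0 J = index_iota 0 J by rewrite /index_iota subn0.
  exact: sum_geometric_le1.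
exists (HalfEll2Op Ab) => /splits_twist[L [M hL]].
pose D := 2 * (`|M| * C * (expR 1 + 1)).
(* [D] is the same for all blocks, so a bounded lifting would bound every natural number. *)
have bound m : m%:R <= D.
  have [hB hV hBVm] := hBV m.
  apply: le_trans (_ : c m * ln (N m).+1%:R <= D); last first.
    apply: (@kp_block_bound _ _ _ _ L M (N m) (fun i => g (m, i : nat))
      (fun j => inord (f j).2) (V m) (c m) C hL _ (ltW (c0 m)) hV) => [i|x i].
      by rewrite gK/= inord_val.
    by rewrite /= /Af gK/= -ltnS ltn_ord inord_val hBVm.
  rewrite mulrC -ler_pdivrMr// -ler_expR lnK ?posrE ?ltr0n//.
  by rewrite ltW// truncnS_gt.
have := bound (Num.truncn D).+1.
by rewrite leNgt truncnS_gt.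
Qed.

End Gluing.

(** * The Hahn-Banach theorem *)

Section HahnBanach.
Variables (R : realType) (k : scalar_kind).
Local Notation K := (scalar_field R k).
Local Notation ofr := (@ofr R k).
Variables (V : lmodType K) (p : V -> R).
Hypothesis p_sub : forall x y, p (x + y) <= p x + p y.
Hypothesis p_hom : forall t x, 0 <= t -> p (ofr t *: x) = t * p x.

Let rcomb t (z w : V * R) : V * R := (ofr t *: z.1 + w.1, t * z.2 + w.2).

(* Domination makes the linear relation [G] single-valued, hence the graph of a linear
   functional on a real subspace. *)
Definition dominated_graph (G : set (V * R)) : Prop :=
  [/\ G (0, 0), forall t z w, G z -> G w -> G (rcomb t z w) &
      forall z, G z -> z.2 <= p z.1].

Let p0 : p 0 = 0.
Proof. by have := p_hom 0 (lexx 0); rewrite ofr0 scale0r mul0r. Qed.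

Let graph_scale G t z : dominated_graph G -> G z -> G (ofr t *: z.1, t * z.2).
Proof. by move=> [G0 Gl _] Gz; have := Gl t _ _ Gz G0; rewrite /rcomb /= !addr0. Qed.

(** Values r and s over x give s - r and r - s over 0, both at most p 0 = 0. *)
Let graph_fun G x r s : dominated_graph G -> G (x, r) -> G (x, s) -> r = s.
Proof.
have le G' u v : dominated_graph G' -> G' (x, u) -> G' (x, v) -> v <= u.
  move=> [G0 Gl Gd] Gu Gv; have := Gd _ (Gl (-1) _ _ Gu Gv).
  by rewrite /= ofrN ofr1 scaleN1r addNr p0 mulN1r addrC subr_le0.
by move=> dG Gr Gs; apply/le_anti; rewrite !(le _ _ _ dG).
Qed.

(** Subadditivity puts every w.2 - p (w.1 - x0) below every w.2-shifted bound p (w.1 + x0) - w.2;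
    the value c at x0 is the supremum of the former. Positive homogeneity reduces a multiple t of x0
    to t = 1 or t = -1. *)
Let graph_extend G x0 : dominated_graph G ->
  exists c, dominated_graph [set z | exists2 w, G w & exists t,
    z = (w.1 + ofr t *: x0, w.2 + t * c)].
Proof.
move=> dG; have [G0 Gl Gd] := dG.
pose B := [set s | exists2 w, G w & s = w.2 - p (w.1 - x0)].
have Bub w : G w -> ubound B (p (w.1 + x0) - w.2).
  move=> Gw _ [v Gv ->]; rewrite lerBlDr addrAC lerBrDr.
  have := Gd _ (Gl 1 _ _ Gv Gw); rewrite /= ofr1 scale1r mul1r => /le_trans; apply.
  have -> : v.1 + w.1 = (w.1 + x0) + (v.1 - x0).
    by rewrite addrACA subrr addr0 addrC.
  exact: p_sub.
have Bsup : has_sup B.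
  split; first by exists (0 - p (0 - x0)), (0, 0).
  by exists (p (0 + x0) - 0); exact: (Bub (0, 0)).
pose c := sup B.
have c1 w : G w -> w.2 - p (w.1 - x0) <= c.
  by move=> Gw; apply: sup_upper_bound => //; exists w.
have c2 w : G w -> c <= p (w.1 + x0) - w.2.
  by move=> Gw; apply: ge_sup (Bub _ Gw); case: Bsup.
exists c; split.
- by exists (0, 0) => //; exists 0; rewrite ofr0 scale0r mul0r !addr0.
- move=> t _ _ [v Gv [a ->]] [w Gw [b ->]]; exists (rcomb t v w); first exact: Gl.
  exists (t * a + b); rewrite /rcomb /=; congr pair.
    by rewrite scalerDr scalerA -ofrM addrACA -scalerDl -ofrD.
  ring.
- move=> _ [w Gw [t ->]] /=.
  have [t0|t0|<-] := ltrgtP 0 t; last by rewrite mul0r ofr0 scale0r !addr0; exact: Gd.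
    have := c2 _ (graph_scale t^-1 dG Gw).
    rewrite -(ler_pM2l t0) /= mulrBr mulVKf ?lt0r_neq0// -p_hom ?(ltW t0)//.
    rewrite scalerDr scalerA -ofrM mulfV ?lt0r_neq0// ofr1 scale1r.
    by lra.
  have s0 : 0 < - t by rewrite oppr_gt0.
  have := c1 _ (graph_scale (- t)^-1 dG Gw).
  rewrite -(ler_pM2l s0) /= mulrBr mulVKf ?lt0r_neq0// -p_hom ?(ltW s0)//.
  rewrite scalerBr scalerA -ofrM mulfV ?lt0r_neq0// ofr1 scale1r ofrN scaleNr opprK.
  by rewrite mulNr; lra.
Qed.

(** Zorn's lemma is applied to sets A with [G0] united with A dominated, which also covers the empty
    chain; by [graph_extend] a maximal A has full domain. *)
Lemma hahn_banach (G0 : set (V * R)) : dominated_graph G0 ->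
  exists g : V -> R, [/\ forall t x y, g (ofr t *: x + y) = t * g x + g y,
    forall x, g x <= p x & forall z, G0 z -> g z.1 = z.2].
Proof.
move=> dG0.
have [|A [dA Amax]] := @Zorn_bigcup _ [set A | dominated_graph (G0 `|` A)].
  move=> F FP Ftot; have [G00 G0l G0d] := dG0; split.
  - by left.
  - have sub X z : F X -> (G0 `|` X) z -> (G0 `|` \bigcup_(X in F) X) z.
      by move=> FX [|Xz]; [left | right; exists X].
    move=> t z w [G0z|[X FX Xz]] [G0w|[Y FY Yw]].
    + by left; exact: G0l.
    + by apply: (sub Y) => //; have [_ + _] := FP _ FY; apply; [left|right].
    + by apply: (sub X) => //; have [_ + _] := FP _ FX; apply; [right|left].
    + have [XY|YX] := Ftot _ _ FX FY.
        apply: (sub Y) => //; have [_ + _] := FP _ FY; apply; right => //; exact: XY.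
      apply: (sub X) => //; have [_ + _] := FP _ FX; apply; right => //; exact: YX.
  - move=> z [/G0d//|[X FX Xz]]; have [_ _] := FP _ FX; apply; by right.
have total x : exists r, (G0 `|` A) (x, r).
  apply: contrapT => nx; have [c] := graph_extend x dA.
  set G := [set _ | _] => dG.
  have AG : G0 `|` A `<=` G.
    by move=> z Gz; exists z => //; exists 0; rewrite ofr0 scale0r mul0r !addr0; case: z {Gz}.
  apply: (Amax G).
    split; first by move=> z Az; apply: AG; right.
    move=> GA; apply: nx; exists c; right; apply: GA.
    have [G00 _ _] := dA; exists (0, 0) => //; exists 1.
    by rewrite ofr1 scale1r mul1r !add0r.
  rewrite /=; have -> // : G0 `|` G = G.
  by apply/seteqP; split => [z [Gz|//]|z Gz]; [apply: AG; left | right].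
have /choice[g gP] := total; have [_ Al Ad] := dA.
exists g; split => [t x y|x|[x r] G0x].
- by apply: (graph_fun dA (gP _)); exact: (Al t _ _ (gP x) (gP y)).
- exact: Ad (gP x).
- by apply: (graph_fun dA (gP x)); left.
Qed.

End HahnBanach.

Lemma norm_complex_le (R : realType) (a b : R) :
  @absr R ComplexScalars (Complex a b) <= `|a| + `|b|.
Proof.
rewrite /absr normc_def /= -[leRHS]ger0_norm ?addr_ge0// -sqrtr_sqr ler_wsqrtr//.
rewrite sqrrD !real_normK ?num_real// lerD2r lerDl.
by rewrite mulrn_wge0// mulr_ge0.
Qed.

(** Over the complex scalars the real part of f is extended to g, and f is recovered through h(x) =
    g(x) - i g(i x). The constant 2 comes from the crude bound |h(x)| <= |g(x)| + |g(i x)|. *)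
Lemma functional_extension (R : realType) (k : scalar_kind)
    (E : normedModType (scalar_field R k)) (A : {pred E}) (f : E -> scalar_field R k) :
  GRing.submod_closed A ->
  (forall a, {in A &, forall x y, f (a *: x + y) = a * f x + f y}) ->
  {in A, forall x, absr (f x) <= rnorm x} ->
  exists g : E -> scalar_field R k,
    [/\ forall a x y, g (a *: x + y) = a * g x + g y, {in A, g =1 f} &
        forall x, absr (g x) <= 2 * rnorm x].
Proof.
case: k E A f => E A f [A0 Al] fl fb.
  have [|||g [gl gp gf]] := @hahn_banach R RealScalars E (@rnorm R RealScalars E) _ _
      [set z | z.1 \in A /\ z.2 = f z.1].
  - exact: rnormD.
  - by move=> t x t0; rewrite rnormZ absr_ofr ger0_norm.
  - split => /=.
    + by split => //; have := fl (-1) 0 0 A0 A0; rewrite scaler0 addr0 mulN1r addNr.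
    + by move=> t z w [zA ->] [wA ->]; split; [exact: Al | rewrite fl].
    + by move=> z [zA ->]; apply: le_trans (fb _ zA); exact: ler_norm.
  exists g; split=> [//|x xA|x]; first exact: (gf (x, f x)).
  apply: (@le_trans _ _ (rnorm x)); last by rewrite ler_peMl ?rnorm_ge0// ler1n.
  rewrite /absr ler_norml gp andbT lerNl.
  have g0 : g 0 = 0 by have := gl (-1) 0 0; rewrite scaler0 addr0 mulN1r addNr.
  have := gp (-1 *: x + 0); rewrite gl g0 addr0 mulN1r addr0 => /le_trans; apply.
  by rewrite scaleN1r rnormN.
pose Re (z : scalar_field R ComplexScalars) : R := complex.Re z.
pose Im (z : scalar_field R ComplexScalars) : R := complex.Im z.
pose i : scalar_field R ComplexScalars := Complex 0 1.
have [|||g [gl gp gf]] := @hahn_banach R ComplexScalars E (@rnorm R ComplexScalars E) _ _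
    [set z | z.1 \in A /\ z.2 = Re (f z.1)].
- exact: rnormD.
- by move=> t x t0; rewrite rnormZ absr_ofr ger0_norm.
- split => /=.
  + by split => //; have := fl (-1) 0 0 A0 A0; rewrite scaler0 addr0 mulN1r addNr => ->.
  + move=> t z w [zA ->] [wA ->]; split; [exact: Al | rewrite fl//].
    by rewrite /Re; case: (f z.1) (f w.1) => a b [c d] /=; rewrite mul0r subr0.
  + move=> z [zA ->]; apply: le_trans (fb _ zA); rewrite /Re /absr.
    case: (f z.1) => a b; rewrite normc_def /= (le_trans (ler_norm _))//.
    by rewrite -sqrtr_sqr ler_wsqrtr// lerDl sqr_ge0.
have g0 : g 0 = 0 by have := gl (-1) 0 0; rewrite scaler0 addr0 mulN1r addNr.
have gN x : g (- x) = - g x.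
  by have := gl (-1) x 0; rewrite !addr0 g0 addr0 mulN1r ofrN ofr1 scaleN1r.
have gb x : `|g x| <= rnorm x.
  rewrite ler_norml gp andbT lerNl -gN.
  by apply: le_trans (gp _) _; rewrite rnormN.
pose h x : scalar_field R ComplexScalars := Complex (g x) (- g (i *: x)).
have ii (x : E) : i *: (i *: x) = - x.
  rewrite scalerA -scaleN1r; congr (_ *: _).
  by rewrite /i; transitivity (Complex (0 * 0 - 1 * 1) (0 * 1 + 1 * 0) : complex R) => //;
    apply/eqP; rewrite eq_complex /= oppr0; apply/andP; split; apply/eqP; ring.
have az (a : scalar_field R ComplexScalars) : a = ofr _ (Re a) + ofr _ (Im a) * i.
  case: a => a b; transitivity
    (Complex (a + (b * 0 - 0 * 1)) (0 + (b * 1 + 0 * 0)) : complex R) => //.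
  by apply/eqP; rewrite eq_complex /=; apply/andP; split; apply/eqP; ring.
have ga a x y : g (a *: x + y) = Re a * g x + Im a * g (i *: x) + g y.
  by rewrite {1}[a]az scalerDl -scalerA -addrA !gl addrA.
exists h; split.
- move=> a x y; rewrite /h.
  rewrite ga scalerDr scalerA [i * a]mulrC -scalerA ga ii gN.
  case: a => a b; transitivity (Complex (a * g x - b * - g (i *: x) + g y)
    (a * - g (i *: x) + b * g x - g (i *: y)) : complex R) => //.
  by congr Complex; rewrite /Re /Im /=; ring.
- move=> x xA; rewrite /h.
  have ixA : i *: x \in A by rewrite -[_ *: _]addr0; exact: Al.
  rewrite (gf (x, Re (f x)))// (gf (i *: x, Re (f (i *: x))))//=.
  have f0 : f 0 = 0 by have := fl (-1) 0 0 A0 A0; rewrite scaler0 addr0 mulN1r addNr.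
  have := fl i x 0 xA A0; rewrite addr0 f0 addr0 => ->.
  by rewrite /Re; case: (f x) => a b /=; congr Complex; ring.
- move=> x; apply: (le_trans (norm_complex_le _ _)); rewrite normrN.
  rewrite mulr2n mulrDl mul1r lerD// (le_trans (gb _))// rnormZ.
  by rewrite /i /absr normc_def /= expr0n add0r expr1n sqrtr1 mul1r.
Qed.

(** * Factorizations from copies of \ell^p_n *)

Section LpSpaces.
Variables (R : realType) (k : scalar_kind).
Local Notation K := (scalar_field R k).
Local Notation ofr := (@ofr R k).

Definition admissible (P : \bar R) : Prop := P = +oo%E \/ exists2 p : R, 1 < p & P = p%:E%E.

Lemma lp_norm_ge0 P n (x : 'rV[K]_n) : 0 <= lp_norm P x.
Proof.
case: P => [p||//] /=; first exact: powR_ge0.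
by elim/big_ind : _ => [//|a b a0 _|i _]; rewrite ?le_max ?a0 ?absr_ge0.
Qed.

Lemma lp_normZ P n t (x : 'rV[K]_n) : admissible P -> 0 <= t ->
  lp_norm P (ofr t *: x) = t * lp_norm P x.
Proof.
have tx i : 0 <= t -> absr ((ofr t *: x) 0 i) = t * absr (x 0 i).
  by move=> t0; rewrite mxE absrM absr_ofr ger0_norm.
move=> [->|[p p1 ->]] t0 /=.
  rewrite (big_morph (fun s => t * s) (id1 := 0) (op1 := Num.max)) ?mulr0//.
    by apply: eq_bigr => i _; rewrite tx.
  by move=> a b; rewrite maxr_pMr.
have p0 : p != 0 by rewrite gt_eqF// (lt_trans ltr01).
under eq_bigr do rewrite tx// powRM ?absr_ge0//.
rewrite -mulr_sumr powRM ?powR_ge0 ?sumr_ge0// => [|i _]; last exact: powR_ge0.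
by rewrite -powRrM mulfV// powRr1.
Qed.

(** Supplies the nonzero vector that excludes zero operator norms in [banach_mazur_lp_iso]. *)
Lemma lp_norm_const_gt0 P n : admissible P -> 0 < lp_norm P (const_mx 1 : 'rV[K]_n.+1).
Proof.
move=> [->|[p p1 ->]] /=.
  rewrite (bigD1 ord0)//= lt_max; apply/orP; left.
  by rewrite mxE absr1.
rewrite powR_gt0//; apply: (@lt_le_trans _ _ 1) => //.
rewrite big_ord_recl mxE absr1 powR1 lerDl sumr_ge0// => i _; exact: powR_ge0.
Qed.

Lemma lp_norm_coord_oo n (x : 'rV[K]_n) i : absr (x 0 i) <= lp_norm +oo%E x.
Proof. by rewrite /= (bigD1 i)//= le_max lexx. Qed.

(* [l] is the [\ell^P] norm of the constant vector 1; for [P = +oo] the exponent 2 is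
   an arbitrary choice. *)
Lemma lp_norm_normalization P : admissible P -> exists2 p : R, 1 < p &
  forall n, exists2 l : R, 0 < l & forall x : 'rV[K]_n.+1,
    ((forall i, absr (x 0 i) <= 1) -> lp_norm P x <= l) /\
    (lp_norm P x <= l -> \sum_i absr (x 0 i) `^ p <= n.+1%:R).
Proof.
move=> [->|[p p1 ->]].
  exists 2 => [|n]; first by rewrite ltr1n.
  exists 1 => // x; split => [x1|xl] /=.
    by elim/big_ind : _ => [//|a b a1 b1|i _]; rewrite ?ge_max ?a1 ?b1 ?x1.
  rewrite -[in leRHS](card_ord n.+1) -sumr_const; apply: ler_sum => i _.
  have x1 : absr (x 0 i) <= 1 := le_trans (lp_norm_coord_oo x i) xl.
  apply: (@le_trans _ _ (1 `^ 2)); last by rewrite powR1.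
  by rewrite ge0_ler_powR ?nnegrE ?absr_ge0.
exists p => // n; exists (n.+1%:R `^ p^-1); first by rewrite powR_gt0// ltr0n.
have p0 : 0 < p by exact: lt_trans p1.
have ip0 : 0 < p^-1 by rewrite invr_gt0.
have s0 (x : 'rV[K]_n.+1) : 0 <= \sum_i absr (x 0 i) `^ p.
  by apply: sumr_ge0 => i _; exact: powR_ge0.
move=> x; split => [x1|] /=.
  rewrite ge0_ler_powR ?nnegrE ?(ltW ip0)//.
  rewrite -[in leRHS](card_ord n.+1) -sumr_const; apply: ler_sum => i _.
  apply: (@le_trans _ _ (1 `^ p)); last by rewrite powR1.
  by rewrite ge0_ler_powR ?nnegrE ?absr_ge0 ?(ltW p0).
by rewrite !leNgt; apply: contra => h; apply: (gt0_ltr_powR ip0); rewrite ?nnegrE.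
Qed.

(** In the complex case the real bound is applied to real and imaginary parts, and C^2 + C^2 <= (2
    C)^2. *)
Lemma rad_bound p : 1 < p -> exists2 C : R, 0 < C &
  forall n (x : cube n -> K), \sum_e absr (x e) `^ p <= 2 ^+ n ->
    \sum_i absr (rad_coef x i) ^+ 2 <= C ^+ 2.
Proof.
move=> p1; have [C C0 hC] := rademacher_coef_bound p1.
have p0 : 0 <= p by rewrite ltW// (lt_trans ltr01).
case: k.
  exists C => // n x /hC; apply: le_trans; apply: ler_sum => i _.
  by rewrite /absr real_normK ?num_real.
exists (2 * C) => [|n x xp]; first by rewrite mulr_gt0.
pose u e := complex.Re (x e : complex R); pose v e := complex.Im (x e : complex R).
have bnd (w : cube n -> R) : (forall e, `|w e| <= absr (x e)) ->
    \sum_i (2 ^- n * \sum_(e : cube n) (-1) ^+ e i * w e) ^+ 2 <= C ^+ 2.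
  move=> wx; apply: hC; apply: le_trans xp; apply: ler_sum => e _.
  by rewrite ge0_ler_powR ?nnegrE ?absr_ge0.
have ub e : `|u e| <= absr (x e).
  rewrite /u /absr; case: (x e) => a b; rewrite normc_def /=.
  by rewrite -sqrtr_sqr ler_wsqrtr// lerDl sqr_ge0.
have vb e : `|v e| <= absr (x e).
  rewrite /v /absr; case: (x e) => a b; rewrite normc_def /=.
  by rewrite -sqrtr_sqr ler_wsqrtr// lerDr sqr_ge0.
have radE i : rad_coef x i = Complex (2 ^- n * \sum_(e : cube n) (-1) ^+ e i * u e)
    (2 ^- n * \sum_(e : cube n) (-1) ^+ e i * v e).
  have xE e : (-1) ^+ (e : cube n) i * x e = Complex ((-1) ^+ e i * u e) ((-1) ^+ e i * v e).
    rewrite /u /v; case: (e i) (x e) => -[a b] /=; rewrite ?expr1 ?expr0 ?mulN1r ?mul1r//.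
  rewrite /rad_coef; under eq_bigr do rewrite xE.
  have -> : \sum_(e : cube n) Complex ((-1) ^+ e i * u e) ((-1) ^+ e i * v e) =
    Complex (\sum_(e : cube n) (-1) ^+ e i * u e) (\sum_(e : cube n) (-1) ^+ e i * v e).
    by elim/big_rec3 : _ => [//|e a b c _ ->].
  move: (\sum_e _) (\sum_e _) => a b.
  by transitivity (Complex (2 ^- n * b - 0 * a) (2 ^- n * a + 0 * b) : complex R) => //;
    congr Complex; ring.
under eq_bigr => i _.
  rewrite radE /absr normc_def /= sqr_sqrtr ?addr_ge0 ?sqr_ge0//.
  over.
rewrite big_split/= exprMn (le_trans (lerD (bnd u ub) (bnd v vb)))//.
by have := sqr_ge0 C; lra.
Qed.

Section Factors.
Variable E : completeNormedModType K.

(** The 2^(n + 1) points of the cube index the coordinates of ell^P. V is S divided by the norm l of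
    the constant vector 1, and B is l times the Rademacher map after U, so the two normalizations
    cancel. The factor 1 + C covers both norm bounds. *)
Lemma cube_factors_of_lp (P : \bar R) (D : R) : admissible P -> 0 < D ->
  (forall n, exists (U : {linear E -> 'rV[K]_n.+1}) (S : {linear 'rV[K]_n.+1 -> E}),
    [/\ forall e, lp_norm P (U e) <= D * rnorm e,
        forall x, rnorm (S x) <= D * lp_norm P x & cancel S U]) ->
  exists2 C : R, 0 < C & cube_factors E C.
Proof.
move=> aP D0 hD; have [p p1 hp] := lp_norm_normalization aP.
have [C C0 hC] := rad_bound p1.
exists (D * (1 + C)) => [|n]; first by rewrite mulr_gt0// addr_gt0.
pose N := #|{: cube n.+1}|.
have N2 : N = (2 ^ n.+1)%N by rewrite /N card_ffun card_bool card_ord.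
have [N' NE] : exists N', N = N'.+1 by exists N.-1; rewrite prednK// N2 expn_gt0.
have [rk [un [rkK unK]]] : exists (rk : cube n.+1 -> 'I_N'.+1) un, cancel rk un /\ cancel un rk.
  rewrite -NE; exists enum_rank, enum_val; split; [exact: enum_rankK | exact: enum_valK].
have [U [S [UD SD SK]]] := hD N'.
have [l l0 hl] := hp N'.
have Bl : linear (fun e => fun i => ofr l * rad_coef (fun c => U e 0 (rk c)) i : K).
  move=> a u v; apply/funext => i.
  transitivity (a * (ofr l * rad_coef (fun c => U u 0 (rk c)) i) +
    ofr l * rad_coef (fun c => U v 0 (rk c)) i) => //.
  rewrite [a * (_ * _)]mulrCA -mulrDr; congr (_ * _).
  rewrite /rad_coef [a * (_ * _)]mulrCA -mulrDr; congr (_ * _).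
  rewrite mulr_sumr -big_split; apply: eq_bigr => c _ /=.
  by rewrite linearP !mxE; ring.
have Vl : linear (fun x : cube n.+1 -> K => ofr l^-1 *: S (\row_j x (un j))).
  move=> a x y.
  have -> : \row_j (a *: x + y) (un j) = a *: \row_j x (un j) + \row_j y (un j).
    by apply/rowP => j; rewrite !mxE.
  by rewrite linearP scalerDr !scalerA mulrC.
exists (mklin Bl), (mklin Vl); split=> [e|x x1|x i].
- have [e0|en0] := eqVneq (rnorm e) 0.
    rewrite (rnorm_eq0 e0) linear0 big1 ?sqr_ge0// => i _.
    by rewrite /GRing.zero/= absr0 expr0n.
  have e0 : 0 < rnorm e by rewrite lt_neqAle eq_sym en0 rnorm_ge0.
  pose t := D * rnorm e; have t0 : 0 < t by rewrite mulr_gt0.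
  (* Rescaling U e to norm at most l brings it under the normalization of [rad_bound]. *)
  pose w := ofr (l / t) *: U e.
  have wl : lp_norm P w <= l.
    rewrite lp_normZ ?divr_ge0 ?(ltW l0) ?(ltW t0)//.
    by rewrite mulrAC ler_pdivrMr// ler_pM2l.
  have := hC _ (fun c => w 0 (rk c)).
  have -> : \sum_e0 absr (w 0 (rk e0)) `^ p = \sum_j absr (w 0 j) `^ p.
    rewrite (reindex rk)//; first by exists un => j _.
  have wp := (hl w).2 wl.
  have N2R : N'.+1%:R = 2 ^+ n.+1 :> R by rewrite -NE N2 natrX.
  rewrite N2R in wp; move=> /(_ wp) h.
  apply: (@le_trans _ _ (t ^+ 2 * C ^+ 2)); last first.
    rewrite -exprMn ler_sqr ?nnegrE ?mulr_ge0 ?addr_ge0 ?(ltW D0) ?(ltW C0) ?(ltW e0)//.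
    by rewrite -subr_ge0 (_ : _ - _ = t) ?(ltW t0)// /t; ring.
  have -> : \sum_i absr (mklin Bl e i) ^+ 2 =
      t ^+ 2 * \sum_i absr (rad_coef (fun c => w 0 (rk c)) i) ^+ 2.
    rewrite mulr_sumr; apply: eq_bigr => i _ /=.
    rewrite -exprMn; congr (_ ^+ 2).
    rewrite -[t]gtr0_norm// -(absr_ofr k) -absrM; congr absr.
    rewrite /rad_coef mulrCA [RHS]mulrCA; congr (_ * _).
    have -> : ofr l = ofr t * ofr (l / t) by rewrite -ofrM mulrC divfK// lt0r_neq0.
    rewrite -mulrA; congr (_ * _); rewrite mulr_sumr.
    by apply: eq_bigr => c _; rewrite mxE mulrCA.
  by rewrite ler_pM2l// exprn_gt0.
- rewrite /= rnormZ absr_ofr gtr0_norm ?invr_gt0// ler_pdivrMl//.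
  apply: (le_trans (SD _)); rewrite mulrC.
  apply: ler_pM; rewrite ?lp_norm_ge0 ?(ltW D0)//.
    by apply: (hl _).1 => j; rewrite mxE.
  by rewrite ler_pMr// lerDl ltW.
- rewrite /= linearZ/= SK /rad_coef mulrCA; congr (_ * _); rewrite mulr_sumr.
  apply: eq_bigr => c _; rewrite !mxE rkK mulrCA [ofr l * (_ * _)]mulrA.
  rewrite -ofrM mulfV ?lt0r_neq0//.
  by rewrite ofr1 mul1r.
Qed.

(** The vector is divided by [NV x] + d instead of [NV x], which may be 0; d absorbs the error for M
    of any sign. *)
Lemma op_norm_bound (V W : lmodType K) (A : {pred V}) (NV : V -> R) (NW : W -> R)
    (f : V -> W) (M : R) :
  (op_norm A NV NW f <= M%:E)%E ->
  (forall t x, x \in A -> ofr t *: x \in A) ->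
  (forall t x, 0 <= t -> NV (ofr t *: x) = t * NV x) ->
  (forall t x, x \in A -> 0 <= t -> NW (f (ofr t *: x)) = t * NW (f x)) ->
  forall x, x \in A -> 0 <= NV x -> NW (f x) <= M * NV x.
Proof.
move=> fM AZ NVZ NWZ x xA x0; apply/ler_addgt0Pr => e e0.
have M1 : 0 < 1 + `|M| by rewrite ltr_pwDl.
pose d := e / (1 + `|M|); have d0 : 0 < d by rewrite divr_gt0.
pose s := NV x + d; have s0 : 0 < s by rewrite ltr_wpDl.
have : NW (f (ofr s^-1 *: x)) <= M.
  rewrite -lee_fin; apply: le_trans fM; apply: ereal_sup_ubound.
  exists (ofr s^-1 *: x) => //; split; first exact: AZ.
  by rewrite NVZ ?invr_ge0 ?(ltW s0)// ler_pdivrMl// mulr1 lerDl ltW.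
rewrite NWZ ?invr_ge0 ?(ltW s0)// ler_pdivrMl// => /le_trans; apply.
rewrite /s mulrDl mulrC lerD2l.
apply: (@le_trans _ _ (d * `|M|)); first by rewrite ler_pM2l// ler_norm.
by rewrite /d mulrAC ler_pdivrMr// ler_pM2l// lerDr.
Qed.

(** The infimum need not be attained, so T and S are chosen with product of norms below |C| + 1;
    then T is divided by its norm and S multiplied by it. *)
Lemma banach_mazur_lp_iso (A : {pred E}) (P : \bar R) n (C : R) :
  admissible P -> GRing.submod_closed A ->
  (banach_mazur A (@rnorm R k E) predT (@lp_norm R k P n.+1) <= C%:E)%E ->
  exists (T : E -> 'rV[K]_n.+1) (S : {linear 'rV[K]_n.+1 -> E}),
  [/\ forall a, {in A &, forall x y, T (a *: x + y) = a *: T x + T y},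
      {in A, forall x, lp_norm P (T x) <= rnorm x}, forall y, S y \in A, cancel S T &
      forall y, rnorm (S y) <= (`|C| + 1) * lp_norm P y].
Proof.
move=> aP [A0 Al] bmC.
have : (banach_mazur A (@rnorm R k E) predT (@lp_norm R k P n.+1) < (`|C| + 1)%:E)%E.
  by apply: (le_lt_trans bmC); rewrite lte_fin (le_lt_trans (ler_norm _))// ltrDl.
move=> /ereal_inf_lt[_ [T [S [[Tl TA SA TK SK] ->]]]] TSC.
have {}SK y : T (S y) = y by exact: SK.
have {}SA y : S y \in A by exact: SA.
have AZ t x : x \in A -> t *: x \in A by move=> xA; rewrite -[_ *: _]addr0 Al.
have T0 : T 0 = 0 by have := Tl (-1) 0 0 A0 A0; rewrite scaler0 addr0 scaleN1r addNr.
have TZ t x : x \in A -> T (t *: x) = t *: T x.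
  by move=> xA; have := Tl t x 0 xA A0; rewrite !addr0 T0 addr0.
have Sl : linear S.
  by move=> a x y; rewrite -[x in LHS]SK -[y in LHS]SK -Tl// TK// Al.
have SZ t x : S (t *: x) = t *: S x by exact: (linearZ_LR (mklin Sl)).
have NVZ (t : R) (x : E) : 0 <= t -> rnorm (ofr t *: x) = t * rnorm x.
  by move=> t0; rewrite rnormZ absr_ofr ger0_norm.
set a := op_norm A _ _ T in TSC; set b := op_norm predT _ _ S in TSC.
have Tb M : (a <= M%:E)%E -> {in A, forall x, lp_norm P (T x) <= M * rnorm x}.
  move=> aM x xA; apply: (op_norm_bound aM) => //; last exact: rnorm_ge0.
  - by move=> t z zA; exact: AZ.
  - by move=> t z zA t0; rewrite TZ// lp_normZ.
have Sb M : (b <= M%:E)%E -> forall y, rnorm (S y) <= M * lp_norm P y.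
  move=> bM y; apply: (op_norm_bound bM) => //; last exact: lp_norm_ge0.
  - by move=> t x t0; rewrite lp_normZ.
  - by move=> t x _ t0; rewrite SZ NVZ.
have one := lp_norm_const_gt0 n aP; set u := const_mx 1 in one.
(* Both norms must be positive before infinite ones can be excluded, since a product of 0 and +oo is
   0. *)
have a0 : (0 < a)%E.
  rewrite ltNge; apply/negP => /Tb/(_ (S u) (SA _)).
  by rewrite SK mul0r leNgt one.
have b0 : (0 < b)%E.
  rewrite ltNge; apply/negP => /Sb/(_ u); rewrite mul0r => Su.
  have Su0 : S u = 0 by apply/rnorm_eq0/le_anti; rewrite Su rnorm_ge0.
  have := lp_normZ u aP (lexx 0); rewrite ofr0 scale0r mul0r -T0 -Su0 SK => u0.
  by rewrite u0 ltxx in one.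
case: a a0 Tb TSC => [al|_ _|//]; last by rewrite gt0_mulye.
case: b b0 Sb => [be|_ _ al0 _|//]; last by rewrite gt0_muley.
rewrite !lte_fin => be0 /(_ be (lexx _)) Sb al0 /(_ al (lexx _)) Tb albe.
have S'l : linear (fun y => ofr al *: S y).
  by move=> c x y; rewrite Sl scalerDr !scalerA mulrC.
exists (fun x => ofr al^-1 *: T x), (mklin S'l); split.
- by move=> c x y xA yA; rewrite Tl// scalerDr !scalerA mulrC.
- move=> x xA; rewrite lp_normZ ?invr_ge0 ?(ltW al0)// ler_pdivrMl//.
  exact: Tb.
- by move=> y /=; exact: AZ.
- move=> y /=; rewrite TZ// SK scalerA -ofrM mulVf ?lt0r_neq0//.
  by rewrite ofr1 scale1r.
- move=> y /=; rewrite NVZ ?(ltW al0)//.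
  apply: (@le_trans _ _ (al * (be * lp_norm P y))); first by rewrite ler_pM2l.
  by rewrite mulrA ler_wpM2r ?lp_norm_ge0// ltW.
Qed.

(** Each coordinate of T extends to E with norm at most 2, and for the sup norm these extensions
    together still have norm at most 2; no projection is involved. The constant |C| + 2 dominates
    both 2 and |C| + 1. *)
Lemma cube_factors_linfty : contains_lpn_uniformly +oo%E E ->
  exists2 C : R, 0 < C & cube_factors E C.
Proof.
move=> [C hC].
have D0 : 0 < `|C| + 2 by rewrite ltr_wpDl.
apply: (@cube_factors_of_lp +oo%E (`|C| + 2)) => [|//|n]; first by left.
have [A [Asub /banach_mazur_lp_iso]] := hC n.+1 isT.
move=> /(_ (or_introl erefl) Asub)[T [S [Tl Tb SA SK Sb]]].
have /choice[g hg] (j : 'I_n.+1) : exists g : E -> K,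
    [/\ forall a x y, g (a *: x + y) = a * g x + g y, {in A, g =1 fun x => T x 0 j} &
        forall x, absr (g x) <= 2 * rnorm x].
  apply: functional_extension => // [a x y xA yA|x xA]; first by rewrite Tl// !mxE.
  by rewrite (le_trans (lp_norm_coord_oo _ _))// Tb.
have Ul : linear (fun e => \row_j g j e).
  by move=> a x y; apply/rowP => j; rewrite !mxE; have [-> _ _] := hg j.
exists (mklin Ul), S; split=> [e|x|x].
- apply: (@le_trans _ _ (2 * rnorm e)).
    rewrite /=; elim/big_ind : _ => [|a b ha hb|j _].
    + by rewrite mulr_ge0// rnorm_ge0.
    + by rewrite ge_max ha hb.
    + by rewrite mxE; have [_ _] := hg j.
  by rewrite ler_wpM2r ?rnorm_ge0// lerDr.
- by rewrite (le_trans (Sb _))// ler_wpM2r ?lp_norm_ge0// lerD2l ler1n.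
- apply/rowP => j; rewrite mxE; have [_ gT _] := hg j.
  by rewrite (gT _ (SA x)) SK.
Qed.

(** Here the projection [Q] extends T to all of E, with norm at most C. *)
Lemma cube_factors_lp (p : R) : 1 < p -> contains_lpn_uniformly_complemented p%:E%E E ->
  exists2 C : R, 0 < C & cube_factors E C.
Proof.
move=> p1 [C hC].
have aP : admissible p%:E by right; exists p.
have D0 : 0 < `|C| + 1 by rewrite ltr_wpDl.
apply: (@cube_factors_of_lp p%:E (`|C| + 1)) => [//|//|n].
have [A [Asub bmA [Q [[QA Qid] QC]]]] := hC n.+1 isT.
have [T [S [Tl Tb SA SK Sb]]] := banach_mazur_lp_iso aP Asub bmA.
have Ul : linear (fun e => T (Q e)) by move=> a x y; rewrite linearP Tl.
exists (mklin Ul), S; split=> [e|//|x]; last by rewrite /= Qid.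
rewrite (le_trans (Tb _ (QA e)))//.
apply: (@le_trans _ _ (C * rnorm e)).
  apply: (op_norm_bound QC) => //; last exact: rnorm_ge0.
  - by move=> t x t0; rewrite rnormZ absr_ofr ger0_norm.
  - by move=> t x _ t0; rewrite linearZ/= rnormZ absr_ofr ger0_norm.
by rewrite ler_wpM2r ?rnorm_ge0// (le_trans (ler_norm _))// lerDl.
Qed.

End Factors.
End LpSpaces.

Theorem corollary4p4 (R : realType) (k : scalar_kind)
    (E : completeNormedModType (scalar_field R k)) :
  contains_lpn_uniformly +oo%E E \/
  (exists2 p : R, (1 < p)%R & contains_lpn_uniformly_complemented p%:E%E E) ->
  exists (Y : completeNormedModType (scalar_field R k))
         (j : {linear ell2 R k -> Y}) (q : {linear Y -> E}),
    twisted_sum j q /\ ~ splits q.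
Proof.
move=> hE.
have [C C0 hC] : exists2 C : R, 0 < C & cube_factors E C.
  by case: hE => [/cube_factors_linfty|[p p1 /(cube_factors_lp p1)]].
have [A nA] := nonsplit_twist C0 hC.
exists (twist A : completeNormedModType _), (twist_inj A), (twist_proj A).
by split => //; exact: twisted_sum_twist.
Qed.
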